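(* Fix $\alpha\in\left(0,\frac12\right)$ and $C>0$, and suppose that $1<pn^\alpha<C$ for all sufficiently large $n$. Then for every $\varepsilon>0$ there exists $n_0$ such that for all $n\ge n_0$, both $u_2(n,p)$ and $u_2'(n,p)$ are at least $\left(2-2\alpha-\varepsilon\right)\frac{\ln n}{p}$.
   Context: $G(n,p)$ is the Erdős–Rényi random graph on $n$ labelled vertices (vertex set $V$), each edge present independently with probability $p=p(n)$; $\mathbb{P}_{n,p}$ is the corresponding probability. A diameter graph in $\mathbb{R}^d$ is a graph $(V,E)$ with $V\subset\mathbb{R}^d$ finite and $E=\{\{\mathbf{x},\mathbf{y}\}\subseteq V: |\mathbf{x}-\mathbf{y}|=\operatorname{diam}V\}$, where $\operatorname{diam}V=\max_{\mathbf{x},\mathbf{y}\in V}|\mathbf{x}-\mathbf{y}|$ (Euclidean norm); a graph is a diameter graph in $\mathbb{R}^d$ if it is isomorphic to one. $u_d(n,p)$ is the largest positive integer $k$ such that $\mathbb{P}_{n,p}\big(\exists W\subseteq V,\ |W|=k,\ G[W]$ is a diameter graph in $\mathbb{R}^d$ and $\chi(G[W])=d+1\big)>\frac12$, where $G[W]$ is the induced subgraph; if no such $k$ exists, $u_d(n,p)=0$. $u_d'(n,p)$ is defined identically with the additional requirement that $G[W]$ be connected. *)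

(* Defs.v *)
From HB Require Import structures.
From mathcomp Require Import all_boot.
From Stdlib Require Import Reals ClassicalDescription.

Set Implicit Arguments. Unset Strict Implicit. Unset Printing Implicit Defensive.

(* potential edges {i,j}, encoded as ordered pairs (i,j) with i < j *)
Definition pairs_pred (n : nat) : pred ('I_n * 'I_n) := fun x => (x.1 < x.2)%N.
Notation edge_slot n := {x : 'I_n * 'I_n | pairs_pred x}.

Definition graph (n : nat) := {set edge_slot n}.

Definition adj (n : nat) (g : graph n) (i j : 'I_n) : bool :=
  [exists e in g, (val e == (i, j)) || (val e == (j, i))].

Definition gnp_weight (n : nat) (p : R) (g : graph n) : R :=
  (p ^ #|g| * (1 - p) ^ (#|{: edge_slot n}| - #|g|))%R.

Definition gnp_prob (n : nat) (p : R) (A : graph n -> Prop) : R :=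
  \big[Rplus/0%R]_(g : graph n)
     (if excluded_middle_informative (A g) then gnp_weight p g else 0%R).

Definition point (d : nat) := 'I_d -> R.

Definition euclid_dist (d : nat) (x y : point d) : R :=
  sqrt (\big[Rplus/0%R]_(k < d) Rsqr (x k - y k)%R).

(* diam of the point set f(W) (distances are >= 0, so 0 is a neutral start) *)
Definition diam_img (n d : nat) (W : {set 'I_n}) (f : 'I_n -> point d) : R :=
  \big[Rmax/0%R]_(x in W) \big[Rmax/0%R]_(y in W) euclid_dist (f x) (f y).

Definition is_diameter_graph (d n : nat) (g : graph n) (W : {set 'I_n}) : Prop :=
  exists f : 'I_n -> point d,
    (forall x y, x \in W -> y \in W -> f x = f y -> x = y) /\
    (forall x y, x \in W -> y \in W -> x <> y ->
       (adj g x y <-> euclid_dist (f x) (f y) = diam_img W f)).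

Definition colorable (n : nat) (g : graph n) (W : {set 'I_n}) (k : nat) : Prop :=
  exists c : 'I_n -> nat,
    (forall x, x \in W -> (c x < k)%N) /\
    (forall x y, x \in W -> y \in W -> adj g x y -> c x <> c y).

Definition chromatic_eq (n : nat) (g : graph n) (W : {set 'I_n}) (k : nat) : Prop :=
  colorable g W k /\ (forall k', colorable g W k' -> (k <= k')%N).

Definition induced_connected (n : nat) (g : graph n) (W : {set 'I_n}) : Prop :=
  forall x y, x \in W -> y \in W ->
    connect (fun a b => [&& a \in W, b \in W & adj g a b]) x y.

Definition good_event (d n k : nat) (conn : bool) (g : graph n) : Prop :=
  exists W : {set 'I_n},
    #|W| = k /\ is_diameter_graph d g W /\ chromatic_eq g W d.+1 /\
    (conn -> induced_connected g W).

(* largest positive k with P(event) > 1/2, or 0.  Since |W| = k <= n is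
   required, only k <= n can have positive probability, so maximizing over
   k < n.+1 is exactly the paper's definition. *)
Definition u_gen (conn : bool) (d n : nat) (p : R) : nat :=
  \max_(k < n.+1 | (0 < k)%N &&
        (if Rlt_dec (1/2)%R (gnp_prob p (@good_event d n k conn)) then true else false))
     (k : nat).

Definition u_d (d n : nat) (p : R) : nat := u_gen false d n p.
Definition u_d' (d n : nat) (p : R) : nat := u_gen true d n p.

(* Main.v *)
(** The witness is an induced odd cycle of length about [n ^ (alpha - delta)]
    together with [s], about [(2 - 2 alpha - eps) ln n / p], pairwise non-adjacent
    vertices, each having exactly one neighbour on the cycle.  Placing the cycle on
    a regular polygon so that its edges are the longest diagonals, and the other
    vertices near the middle of the arcs of the Reuleaux polygon over it, shows
    that this is a diameter graph in the plane; the odd cycle forces chromatic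
    number 3, and the graph is connected, so one witness serves both parameters.

    To find it, the vertices are split into three classes A, D, B of size [n / 3],
    exposed in turn.  A union bound over all vertex sets of the size of a path
    shows that induced paths in A can be extended greedily; a vertex of D closes
    the path into a cycle since [p ^ 2 n] tends to infinity ([alpha < 1/2]); and the
    second moment method, with overlaps [j] contributing at most [11 ^ -j], gives
    the pendant vertices in B.  The cycle must be almost as long as [1 / p]: then a
    given vertex of B is a pendant with probability [q >= n ^ - delta], which costs
    only a lower order factor in the second moment. *)

Require Import Defs.
From mathcomp Require Import all_boot all_order all_algebra.

Set Implicit Arguments. Unset Strict Implicit. Unset Printing Implicit Defensive.

(** * Product measure on subsets of a finite type *)

(** The expected number of admissible sets of [s] pendants among [m] candidates is C(m, s) q^s (1 -
    p)^(s (s - 1) / 2), which stays large up to about s = 2 ln(n p q) / p. With q near 1 this is the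
    order (2 - 2 alpha) ln n / p of the largest independent sets. Over a triangle q would be of
    order p, and the constant would drop to 2 - 4 alpha. A cycle much longer than 1 / p fails too,
    since (1 - p)^L then makes a single neighbour unlikely. The condition alpha < 1/2 acts three
    times: L ln n must be small against p n for the path, p^2 n large for the closing vertex, and
    s^2 small against n so that pendant sets with a small overlap do not spoil the second moment.
    Each time a positive power of n is left over, and all constants, logarithms and the loss in q
    are paid from it. The first two stages fail with probability at most 1/10 each and the third
    succeeds with probability at least 10/11. The product 81/110 exceeds 1/2; the ratio 11^-j is
    chosen because its sum over j >= 1 is 1/10. *)

Section ProductMeasure.
Import Order.TTheory GRing.Theory Num.Theory.
Local Open Scope ring_scope.

Variables (F : realFieldType) (T : finType) (p : F).
Hypotheses (p_ge0 : 0 <= p) (p_le1 : p <= 1).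
Implicit Types (g E : {set T}) (f h : {set T} -> F) (P Q : {set T} -> bool).

Definition weight g : F := \prod_(e : T) (if e \in g then p else 1 - p).
Definition Ex f : F := \sum_(g : {set T}) weight g * f g.
Definition Pr P : F := Ex (fun g => (P g)%:R).
Definition depends (A : Type) E (f : {set T} -> A) := forall g, f (g :&: E) = f g.

Lemma weight_ge0 g : 0 <= weight g.
Proof. by apply: prodr_ge0 => e _; case: ifP => _ //; rewrite subr_ge0. Qed.

Lemma weight_card g : weight g = p ^+ #|g| * (1 - p) ^+ (#|T| - #|g|).
Proof.
rewrite /weight (bigID (mem g)) /=; congr (_ * _).
  by rewrite (eq_bigr (fun=> p)) ?prodr_const // => e ->.
rewrite (eq_bigr (fun=> 1 - p)) => [|e /negbTE-> //].
rewrite (eq_bigl (mem (~: g))) => [|e]; last by rewrite /= inE.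
by rewrite prodr_const -(cardsC g) addKn.
Qed.

(** Expanding the product of sums on the right gives one term for each subset. The total mass and
    the probability of a prescribed pattern are both special cases. *)
Lemma Ex_prod (a b : T -> F) :
  Ex (fun g => \prod_e (if e \in g then a e else b e)) =
  \prod_e (p * a e + (1 - p) * b e).
Proof.
rewrite bigA_distr; apply: eq_bigr => g _; rewrite -big_split /=.
by apply: eq_bigr => e _; case: ifP.
Qed.

Lemma Ex1 : Ex (fun=> 1) = 1.
Proof.
transitivity (\prod_(e : T) (p * 1 + (1 - p) * 1) : F).
  rewrite -Ex_prod; apply: eq_bigr => g _.
  by rewrite [in RHS]big1 // => e _; case: ifP.
by rewrite big1 // => e _; rewrite !mulr1 addrC subrK.
Qed.

Lemma eq_Ex f h : f =1 h -> Ex f = Ex h.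
Proof. by move=> eq_fh; apply: eq_bigr => g _; rewrite eq_fh. Qed.

Lemma Ex_le f h : (forall g, f g <= h g) -> Ex f <= Ex h.
Proof. by move=> le_fh; apply: ler_sum => g _; rewrite ler_wpM2l ?weight_ge0. Qed.

Lemma Ex_ge0 f : (forall g, 0 <= f g) -> 0 <= Ex f.
Proof. by move=> f0; apply: sumr_ge0 => g _; rewrite mulr_ge0 ?weight_ge0. Qed.

Lemma Ex_sum (I : finType) (D : pred I) (f : I -> {set T} -> F) :
  Ex (fun g => \sum_(i | D i) f i g) = \sum_(i | D i) Ex (f i).
Proof. by rewrite exchange_big; apply: eq_bigr => g _; rewrite mulr_sumr. Qed.

Lemma Ex_scale c f : Ex (fun g => c * f g) = c * Ex f.
Proof. by rewrite mulr_sumr; apply: eq_bigr => g _; rewrite mulrCA. Qed.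

Lemma Ex_add f h : Ex (fun g => f g + h g) = Ex f + Ex h.
Proof. by rewrite -big_split; apply: eq_bigr => g _; rewrite mulrDr. Qed.

Lemma dependsW (A : Type) E E' (f : {set T} -> A) :
  E \subset E' -> depends E f -> depends E' f.
Proof. by move=> sEE' dE g; rewrite -dE -setIA (setIidPr sEE') dE. Qed.

(* Exchanging the parts outside E of two independent copies preserves the
   joint weight, and turns [f g * h g'] into [f g * h g]. *)
Lemma Ex_indep E E' f h : depends E f -> depends E' h -> [disjoint E & E'] ->
  Ex (fun g => f g * h g) = Ex f * Ex h.
Proof.
move=> dE dE' disj.
pose mix g g' := (g :&: E) :|: (g' :\: E).
pose sw (x : {set T} * {set T}) := (mix x.1 x.2, mix x.2 x.1).
have swK : involutive sw.
  case=> a b; congr (_, _); apply/setP=> e; rewrite !inE /=;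
  by case: (e \in E); rewrite ?andbT ?andbF ?orbF.
have wsw a b : weight (mix a b) * weight (mix b a) = weight a * weight b.
  rewrite -!big_split; apply: eq_bigr => e _; rewrite !inE /=.
  by case: (e \in E); rewrite ?andbT ?andbF ?orbF //= mulrC.
(* The total mass 1 supplies the second, independent copy. *)
have -> : Ex (fun g => f g * h g) = Ex (fun g => f g * h g) * Ex (fun=> 1).
  by rewrite Ex1 mulr1.
rewrite !big_distrlr /= !pair_bigA /=.
rewrite [LHS](reindex_inj (inv_inj swK)) /=.
apply: eq_bigr => -[a b] _ /=.
have -> : f (mix a b) = f a.
  rewrite -[RHS]dE -dE; congr f; apply/setP=> e; rewrite !inE.
  by case: (e \in E); rewrite ?andbT ?andbF ?orbF.
have -> : h (mix a b) = h b.
  rewrite -[RHS]dE' -dE'; congr h; apply/setP=> e; rewrite !inE.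
  case: (boolP (e \in E')) => [eE'|]; rewrite ?andbF //.
  by rewrite (disjointFl disj eE') andbF orFb !andbT.
by rewrite mulr1 mulrAC wsw [RHS]mulrACA.
Qed.

Lemma Pr_mono P Q : (forall g, P g -> Q g) -> Pr P <= Pr Q.
Proof.
move=> sPQ; apply: Ex_le => g; rewrite ler_nat.
by case: (P g) (sPQ g) => // ->.
Qed.

Lemma eq_Pr P Q : P =1 Q -> Pr P = Pr Q.
Proof. by move=> eqPQ; apply: eq_Ex => g; rewrite eqPQ. Qed.

Lemma Pr_ge0 P : 0 <= Pr P.
Proof. by apply: Ex_ge0 => g; rewrite ler0n. Qed.

Lemma Pr_compl P : Pr (fun g => ~~ P g) = 1 - Pr P.
Proof.
rewrite -Ex1; apply/eqP; rewrite eq_sym subr_eq -Ex_add; apply/eqP/eq_Ex => g.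
by case: (P g); rewrite /= ?addr0 ?add0r.
Qed.

Lemma Pr_union (I : finType) (P : I -> {set T} -> bool) :
  Pr (fun g => [exists i, P i g]) <= \sum_i Pr (P i).
Proof.
rewrite -(Ex_sum predT (fun i g => (P i g)%:R)); apply: Ex_le => g.
case: existsP => [[i Pi]|_]; last by apply: sumr_ge0 => i _; rewrite ler0n.
by rewrite (bigD1 i) //= Pi lerDl sumr_ge0 // => j _; rewrite ler0n.
Qed.

Lemma Pr_pattern (A B : {set T}) : [disjoint A & B] ->
  Pr (fun g => (A \subset g) && [disjoint B & g]) = p ^+ #|A| * (1 - p) ^+ #|B|.
Proof.
(* The indicator of the pattern is a product over the elements: one of [B] must not lie in [g], one
   of [A] must not lie outside it. *)
move=> dAB; pose a e : F := (e \notin B)%:R; pose b e : F := (e \notin A)%:R.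
transitivity (Ex (fun g => \prod_e (if e \in g then a e else b e))).
  apply: eq_Ex => g; case: andP => [[/subsetP sAg dBg]|nAB].
    rewrite big1 // => e _; case: ifP => [eg|neg]; rewrite /a /b.
      by rewrite (disjointFl dBg eg).
    by rewrite (contra (sAg e)) ?neg.
  apply/esym/eqP/prodf_eq0; case: (boolP (A \subset g)) => sAg; last first.
    case/subsetPn: sAg => e eA neg; exists e => //.
    by rewrite (negbTE neg) /b eA.
  case: (boolP [disjoint B & g]) => dBg; first by case: nAB.
  case/pred0Pn: dBg => e /andP[/= eB eg]; exists e => //.
  by rewrite eg /a eB.
rewrite Ex_prod (bigID (mem A)) /= (eq_bigr (fun=> p)) => [|e eA]; last first.
  by rewrite /a /b eA (disjointFr dAB eA) mulr1 mulr0 addr0.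
rewrite prodr_const; congr (_ * _); rewrite (bigID (mem B)) /=.
rewrite [X in _ * X]big1 => [|e /andP[nA nB]]; last first.
  by rewrite /a /b nA nB !mulr1 addrC subrK.
rewrite mulr1 (eq_big (mem B) (fun=> 1 - p)) ?prodr_const // => e.
  by rewrite -[RHS]/(e \in B); case: (boolP (e \in B)) => [/(disjointFl dAB)->|]; rewrite ?andbF.
by case/andP=> nA eB; rewrite /a /b nA eB mulr0 add0r mulr1.
Qed.

Lemma Ex_prod_indep (I : finType) (Y : {set I}) (E_ : I -> {set T})
    (f_ : I -> {set T} -> F) E h :
  (forall i, i \in Y -> depends (E_ i) (f_ i)) -> depends E h ->
  (forall i, i \in Y -> [disjoint E_ i & E]) ->
  (forall i j, i \in Y -> j \in Y -> i != j -> [disjoint E_ i & E_ j]) ->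
  Ex (fun g => \prod_(i in Y) f_ i g * h g) = \prod_(i in Y) Ex (f_ i) * Ex h.
Proof.
move=> dep_f dep_h dis_h dis_f.
under eq_Ex => g do rewrite -big_enum.
rewrite -big_enum /=.
have memY i : i \in enum Y -> i \in Y by rewrite mem_enum.
have {}dis_h i : i \in enum Y -> [disjoint E_ i & E] by move/memY/dis_h.
elim: (enum Y) (enum_uniq Y) memY h E dep_h dis_h => /= [|i r IHr] => [_ _|].
  move=> h E dh _; rewrite big_nil mul1r; apply: eq_Ex => g.
  by rewrite big_nil mul1r.
case/andP=> ri uniq_r sYr h E dh disE.
have iY : i \in Y by rewrite sYr ?mem_head.
have sY j : j \in r -> j \in Y by move=> rj; rewrite sYr // inE rj orbT.
(* The factor just split off is absorbed into [h], whose slot set grows to [E_ i :|: E]; the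
   induction therefore runs over all [h] and [E]. *)
rewrite big_cons -mulrA mulrCA -(Ex_indep (dep_f _ iY) dh (disE _ (mem_head i r))).
rewrite -(IHr uniq_r sY _ (E_ i :|: E)).
- by apply: eq_Ex => g; rewrite big_cons -mulrA mulrCA.
- move=> g; congr (_ * _).
    by apply: (dependsW (subsetUl _ E)); apply: dep_f.
  by apply: (dependsW (subsetUr (E_ i) _)).
move=> j rj; rewrite -setI_eq0 setIUr setU_eq0 !setI_eq0 disE ?inE ?rj ?orbT // andbT.
by apply: dis_f => //; [apply: sY | apply: contraNneq ri => <-].
Qed.

Lemma natr_forall_in (I : finType) (Y : {set I}) (b : I -> bool) :
  ([forall i in Y, b i]%:R : F) = \prod_(i in Y) (b i)%:R.
Proof.
case: forall_inP => [bY|nbY].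
  by rewrite big1 // => i /bY->.
case: (boolP [exists i in Y, ~~ b i]) => [/exists_inP[i iY nbi]|].
  by rewrite (bigD1 i) //= (negbTE nbi) mul0r.
rewrite negb_exists_in => /forall_inP bY; case: nbY => i /bY.
by rewrite negbK.
Qed.

Lemma Pr_forall_and (I : finType) (Y : {set I}) (E_ : I -> {set T})
    (P_ : I -> {set T} -> bool) E Q :
  (forall i, i \in Y -> depends (E_ i) (P_ i)) -> depends E Q ->
  (forall i, i \in Y -> [disjoint E_ i & E]) ->
  (forall i j, i \in Y -> j \in Y -> i != j -> [disjoint E_ i & E_ j]) ->
  Pr (fun g => [forall i in Y, P_ i g] && Q g) = \prod_(i in Y) Pr (P_ i) * Pr Q.
Proof.
move=> dP dQ disQ disP.
rewrite -(Ex_prod_indep (E_ := E_) (E := E)) //.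
- by apply: eq_Ex => g; rewrite -natr_forall_in -natrM mulnb.
- by move=> i iY g; rewrite dP.
- by move=> g; rewrite dQ.
Qed.

Lemma Pr_forall (I : finType) (Y : {set I}) (E_ : I -> {set T})
    (P_ : I -> {set T} -> bool) :
  (forall i, i \in Y -> depends (E_ i) (P_ i)) ->
  (forall i j, i \in Y -> j \in Y -> i != j -> [disjoint E_ i & E_ j]) ->
  Pr (fun g => [forall i in Y, P_ i g]) = \prod_(i in Y) Pr (P_ i).
Proof.
move=> dP disP.
transitivity (Pr (fun g => [forall i in Y, P_ i g] && predT g)).
  by apply: eq_Pr => g; rewrite andbT.
rewrite (Pr_forall_and (E_ := E_) (E := set0)) //.
  by rewrite -[RHS]mulr1 -Ex1.
by move=> i _; rewrite -setI_eq0 setI0.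
Qed.

(* Two rounds of exposure: a witness of the first round is chosen as a function
   of the slots in E, hence independently of the slots in E'. *)
Lemma Pr_two_rounds (Z : finType) E E' (V : pred Z)
    (P_ Q_ : Z -> {set T} -> bool) (a : F) :
  (forall z, depends E (P_ z)) -> (forall z, V z -> depends E' (Q_ z)) ->
  [disjoint E & E'] -> (forall z g, P_ z g -> V z) ->
  (forall z, V z -> a <= Pr (Q_ z)) ->
  Pr (fun g => [exists z, P_ z g]) * a <=
  Pr (fun g => [exists z, P_ z g && Q_ z g]).
Proof.
move=> dP dQ disE PV leaQ.
(* For each [g] at most one [z] is first, so the events [first z] partition the success of the first
   round and summing over [z] loses nothing. *)
pose first z g := [pick z | P_ z g] == Some z.
have dfirst z : depends E (first z).
  by move=> g; rewrite /first (eq_pick (fun z => dP z g)).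
have firstP z g : first z g -> P_ z g.
  by rewrite /first; case: pickP => // x Px /eqP[<-].
have sum_first g (b : pred Z) :
    \sum_z (first z g && b z)%:R =
    (if [pick z | P_ z g] is Some z then (b z)%:R else 0) :> F.
  rewrite /first; case: pickP => [x Px|_]; last by rewrite big1.
  rewrite (bigD1 x) //= eqxx big1 ?addr0 // => z nzx.
  by case: eqP => // -[xz]; rewrite xz eqxx in nzx.
have -> : Pr (fun g => [exists z, P_ z g]) = \sum_z Pr (first z).
  rewrite -(Ex_sum predT (fun z g => (first z g)%:R)); apply: eq_Ex => g.
  under eq_bigr => z _ do rewrite -[first z g]andbT.
  rewrite (sum_first g xpredT); case: pickP => [x Px|nP].
    by rewrite (introT existsP) //; exists x.
  by case: existsP => // -[x]; rewrite nP.
apply: le_trans (_ : \sum_z Pr (fun g => first z g && Q_ z g) <= _).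
  rewrite mulr_suml; apply: ler_sum => z _; case: (boolP (V z)) => [Vz|nVz].
    have -> : Pr (fun g => first z g && Q_ z g) = Pr (first z) * Pr (Q_ z).
      rewrite -(Ex_indep (E := E) (E' := E')) //.
      - by apply: eq_Ex => g; rewrite -natrM mulnb.
      - by move=> g; rewrite dfirst.
      - by move=> g; rewrite dQ.
    by rewrite ler_wpM2l ?Pr_ge0 ?leaQ.
  have -> : Pr (first z) = 0.
    apply: big1 => g _; case: (boolP (first z g)) => [/firstP/PV|]; last first.
      by rewrite mulr0.
    by rewrite (negbTE nVz).
  by rewrite mul0r Pr_ge0.
rewrite -(Ex_sum predT (fun z g => (first z g && Q_ z g)%:R)).
apply: Ex_le => g; rewrite (sum_first g (fun z => Q_ z g)).
case: pickP => [x Px|_]; last exact: ler0n.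
rewrite ler_nat; case: (boolP (Q_ x g)) => // Qx.
by rewrite (introT existsP) //; exists x; rewrite Px.
Qed.

(** Let [Y] count the events that occur and [hit] indicate [Y > 0], so [hit * Y = Y]. Expanding the
    mean of [(hit - t * Y) ^+ 2], which is nonnegative, gives at least [2 t M - t^2 K M^2] for the
    probability of [hit]; the best choice [t = 1 / (K M)] makes this [1 / K]. *)
Lemma second_moment (I : finType) (D : pred I) (P_ : I -> {set T} -> bool)
    (M K : F) : 0 < M -> 0 < K ->
  \sum_(i | D i) Pr (P_ i) = M ->
  \sum_(i | D i) \sum_(j | D j) Pr (fun g => P_ i g && P_ j g) <= K * M ^+ 2 ->
  K^-1 <= Pr (fun g => [exists i, D i && P_ i g]).
Proof.
move=> M0 K0 EY EY2; pose Y g : F := \sum_(i | D i) (P_ i g)%:R.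
pose hit g : F := [exists i, D i && P_ i g]%:R.
have hitY g : hit g * Y g = Y g.
  rewrite /hit; case: existsP => [_|nP]; first by rewrite mul1r.
  rewrite mul0r /Y big1 // => i Di; case: (boolP (P_ i g)) => // Pi.
  by case: nP; exists i; rewrite Di.
have hit2 g : hit g * hit g = hit g by rewrite -natrM mulnb andbb.
have ExY : Ex Y = M by rewrite Ex_sum.
have ExY2 : Ex (fun g => Y g * Y g) <= K * M ^+ 2.
  apply: le_trans EY2; rewrite le_eqVlt.
  under eq_Ex => g do rewrite mulr_suml.
  rewrite Ex_sum; apply/orP; left; apply/eqP/eq_bigr => i _.
  under eq_Ex => g do rewrite mulr_sumr.
  rewrite Ex_sum; apply: eq_bigr => j _; apply: eq_Ex => g.
  by rewrite -natrM mulnb.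
pose t := (K * M)^-1.
have : 0 <= Ex (fun g => (hit g + (- (t *+ 2)) * Y g) + t ^+ 2 * (Y g * Y g)).
  apply: Ex_ge0 => g.
  have -> : hit g + - (t *+ 2) * Y g + t ^+ 2 * (Y g * Y g) =
    (hit g - t * Y g) ^+ 2.
    by rewrite sqrrB [hit g ^+ 2]hit2 [hit g * _]mulrCA hitY exprMn -expr2 mulNr mulrnAl.
  by rewrite sqr_ge0.
rewrite Ex_add Ex_add !Ex_scale ExY => h0.
rewrite -[Pr _]/(Ex hit).
have tM : t * M = K^-1 by rewrite /t invfM -mulrA mulVf ?mulr1 ?gt_eqF.
have : t ^+ 2 * Ex (fun g => Y g * Y g) <= K^-1.
  apply: le_trans (ler_wpM2l (sqr_ge0 t) ExY2) _.
  by rewrite mulrCA -exprMn tM expr2 mulrA divff ?mul1r ?gt_eqF.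
move: h0; rewrite mulNr mulrnAl tM => h0 h1.
rewrite -subr_ge0; apply: le_trans h0 _.
by rewrite -addrA lerD2l mulr2n opprD -addrA gerDl addrC subr_le0.
Qed.
End ProductMeasure.

(** * Neighbourhoods in a random graph *)

Section Slots.
Variable n : nat.
Implicit Types (g : graph n) (e : edge_slot n) (i j u v w : 'I_n) (U A X : {set 'I_n}).

Definition joins e i j := (val e == (i, j)) || (val e == (j, i)).

Definition star w U : {set edge_slot n} := [set e | [exists u in U, joins e w u]].

Definition inside A : {set edge_slot n} :=
  [set e | ((val e).1 \in A) && ((val e).2 \in A)].

Definition nbs g w U : {set 'I_n} := [set u in U | adj g w u].

Lemma joins_sym e i j : joins e i j = joins e j i.
Proof. exact: orbC. Qed.

Lemma joins_pairP e i j : reflect (val e = (i, j) \/ val e = (j, i)) (joins e i j).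
Proof. by apply: (iffP orP) => -[] /eqP; [left | right | left | right]. Qed.

Lemma joins_neq e i j : joins e i j -> i != j.
Proof.
by case: e => -[a b] ab /joins_pairP[] [? ?]; subst; move: ab;
  rewrite /pairs_pred /= neq_ltn => ->; rewrite ?orbT.
Qed.

Lemma joins_inj e i j u v : joins e i j -> joins e u v ->
  (i = u /\ j = v) \/ (i = v /\ j = u).
Proof.
by move=> /joins_pairP eij /joins_pairP; case: eij => -> [] [-> ->]; [left | right | right | left].
Qed.

Lemma slot_between i j : i != j -> exists e0, forall e, joins e i j = (e == e0).
Proof.
wlog lt_ij : i j / i < j => [wl ij|_].
  move: (ij); rewrite neq_ltn => /orP[lt|lt]; first exact: wl.
  have [|e0 he0] := wl j i lt; first by rewrite eq_sym.
  by exists e0 => e; rewrite joins_sym he0.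
exists (exist _ (i, j) lt_ij : edge_slot n) => e.
apply/joins_pairP/eqP => [[]|->]; [by move=> ?; apply: val_inj| | by left].
by move=> eji; have := valP e; rewrite eji /pairs_pred /= ltnNge (ltnW lt_ij).
Qed.

Lemma adjP g i j : reflect (exists2 e, e \in g & joins e i j) (adj g i j).
Proof. by apply: (iffP exists_inP) => -[e]; exists e. Qed.

Lemma adj_sym g i j : adj g i j = adj g j i.
Proof. by apply/adjP/adjP => -[e eg]; rewrite joins_sym; exists e. Qed.

Lemma adj_irr g i : adj g i i = false.
Proof. by apply/adjP => -[e _ /joins_neq]; rewrite eqxx. Qed.

Lemma starP e w U : reflect (exists2 u, u \in U & joins e w u) (e \in star w U).
Proof. by rewrite inE; apply: exists_inP. Qed.

Lemma depends_adj (E : graph n) g i j : (forall e, joins e i j -> e \in E) ->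
  adj (g :&: E) i j = adj g i j.
Proof.
move=> sE; apply/adjP/adjP => -[e eg ij]; exists e => //.
  by move: eg; rewrite inE => /andP[].
by rewrite inE eg sE.
Qed.

Lemma depends_nbs w U : depends (star w U) (fun g => nbs g w U).
Proof.
move=> g; apply/setP=> u; rewrite !inE; case: (boolP (u \in U)) => //= uU.
by apply: depends_adj => e wu; apply/starP; exists u.
Qed.

Lemma disjoint_star w w' U : w \notin U -> w' \notin U -> w != w' ->
  [disjoint star w U & star w' U].
Proof.
move=> wU w'U ww'; apply/pred0P=> e /=; apply/andP => -[/starP[u uU eu] /starP[v vU ev]].
have [[Ew _]|[Ew _]] := joins_inj eu ev; first by rewrite Ew eqxx in ww'.
by rewrite Ew vU in wU.
Qed.

Lemma disjoint_star_inside w A U : w \notin A -> [disjoint star w U & inside A].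
Proof.
move=> wA; apply/pred0P=> e /=; apply/andP => -[/starP[u _ /joins_pairP[]]];
by rewrite inE => -> /andP[] /=; rewrite (negbTE wA).
Qed.

Lemma depends_nbs_outside w A U : w \notin A ->
  depends (~: inside A) (fun g => nbs g w U).
Proof.
move=> wA; have sE : star w U \subset ~: inside A.
  by rewrite -disjoints_subset disjoint_star_inside.
exact: (dependsW sE (@depends_nbs w U)).
Qed.

Lemma disjoint_star_inside_set w A U : [disjoint U & A] ->
  [disjoint star w U & inside A].
Proof.
move=> dUA; apply/pred0P=> e /=; apply/andP => -[/starP[u uU /joins_pairP[]]];
by rewrite inE => -> /andP[] /=; rewrite (disjointFr dUA uU).
Qed.

Lemma card_star w U : w \notin U -> #|star w U| = #|U|.
Proof.
move=> wU; pose oth e := if (val e).1 == w then (val e).2 else (val e).1.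
have othE e u : joins e w u -> oth e = u.
  move=> wu; have /negbTE nuw := joins_neq wu.
  by move: wu; rewrite /oth => /joins_pairP[] ->; rewrite /= ?eqxx // eq_sym nuw.
suff othU : oth @: star w U = U.
  rewrite -[in RHS]othU card_in_imset // => e e' /starP[u uU eu] /starP[v vU ev].
  rewrite (othE e u) // (othE e' v) // => uv; subst v.
  have [e0 he0] := slot_between (joins_neq eu).
  by move: eu ev; rewrite !he0 => /eqP-> /eqP->.
apply/setP=> u; apply/imsetP/idP => [[e /starP[v vU ev] ->]|uU].
  by rewrite (othE _ v).
have wu : w != u by apply: contraNneq wU => ->.
have [e0 he0] := slot_between wu; have e0P : joins e0 w u by rewrite he0.
by exists e0; rewrite ?(othE _ u) //; apply/starP; exists u.
Qed.

Lemma star_inter w U X : w \notin U -> w \notin X ->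
  star w U :&: star w X = star w (U :&: X).
Proof.
move=> wU wX; apply/setP=> e; rewrite in_setI; apply/andP/starP.
  move=> [/starP[u uU eu] /starP[v vX ev]]; exists u => //; rewrite inE uU.
  have [[_ ->]|[Ew _]] := joins_inj eu ev; first by [].
  by rewrite Ew vX in wX.
by case=> u; rewrite inE => /andP[uU uX] eu; split; apply/starP; exists u.
Qed.

(** Prescribing the neighbourhood fixes every slot of [star w U], which brings the event into the
    shape of [Pr_pattern]. *)
Lemma nbs_eq g w U X : w \notin U -> X \subset U ->
  (nbs g w U == X) = (star w X \subset g) && [disjoint star w (U :\: X) & g].
Proof.
move=> wU sXU; have neq u : u \in U -> w != u by move=> uU; apply: contraNneq wU => ->.
apply/eqP/andP => [EX|[/subsetP sg /pred0P dg]].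
  split.
    apply/subsetP=> e /starP[u uX eu].
    have : u \in nbs g w U by rewrite EX.
    rewrite inE => /andP[uU /adjP[e' e'g]].
    by have [e0 he0] := slot_between (neq u uU); move: eu; rewrite !he0 => /eqP-> /eqP <-.
  apply/pred0P=> e /=; apply/andP=> -[/starP[u]]; rewrite inE => /andP[uX uU] eu eg.
  move: uX; rewrite -EX inE uU => /adjP; apply; by exists e.
apply/setP=> u; rewrite inE; case: (boolP (u \in U)) => uU /=; last first.
  by apply/esym/negP => /(subsetP sXU); rewrite (negbTE uU).
have [e0 he0] := slot_between (neq u uU); have e0P : joins e0 w u by rewrite he0.
have adjE : adj g w u = (e0 \in g).
  by apply/adjP/idP => [[e eg]|eg]; [rewrite he0 => /eqP <- | exists e0].
rewrite adjE; apply/idP/idP => [eg|uX].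
  apply: contraT => nuX; have := dg e0; rewrite /= eg andbT => <-.
  by apply/starP; exists u; rewrite // inE nuX.
by apply: sg; apply/starP; exists u.
Qed.

Lemma inside_inter A U : inside A :&: inside U = inside (A :&: U).
Proof. by apply/setP=> e; rewrite !inE andbACA. Qed.

Lemma card_inside A : #|inside A| = 'C(#|A|, 2).
Proof.
have [k] := ubnP #|A|; elim: k A => // k IHk A ltAk.
have [->|/set0Pn[x xA]] := eqVneq A set0.
  by rewrite cards0 bin0n eq_card0 // => e; rewrite !inE.
have xA' : x \notin A :\ x by rewrite !inE eqxx.
have -> : inside A = inside (A :\ x) :|: star x (A :\ x).
  apply/setP=> e; rewrite in_setU; apply/idP/orP.
    rewrite !inE => /andP[a1 a2].
    have [e1|n1] := eqVneq (val e).1 x; have [e2|n2] := eqVneq (val e).2 x.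
    - have := valP e; rewrite /pairs_pred (surjective_pairing (val e)) e1 e2 /=.
      by rewrite ltnn.
    - right; apply/exists_inP; exists (val e).2; rewrite ?inE ?n2 //.
      by apply/joins_pairP; left; rewrite -e1 -surjective_pairing.
    - right; apply/exists_inP; exists (val e).1; rewrite ?inE ?n1 //.
      by apply/joins_pairP; right; rewrite -e2 -surjective_pairing.
    - by left; rewrite a1 a2.
  case; first by rewrite !inE => /andP[/andP[_ ->] /andP[_ ->]].
  by case/starP=> u; rewrite !inE => /andP[_ uA] /joins_pairP[] -> /=; rewrite xA uA.
rewrite cardsU disjoint_setI0; last first.
  by rewrite disjoint_sym disjoint_star_inside.
rewrite cards0 subn0 IHk ?card_star //.
  by rewrite [in RHS](cardsD1 x A) xA binS bin1.
by move: ltAk; rewrite (cardsD1 x A) xA.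
Qed.

(** Removing [J] is a bijection onto the subsets of [B :\: J] of size [s - #|J|]. *)
Lemma card_supersets (B J : {set 'I_n}) s : J \subset B -> #|J| <= s ->
  #|[set S : {set 'I_n} | [&& S \subset B, #|S| == s & J \subset S]]| =
  'C(#|B| - #|J|, s - #|J|).
Proof.
move=> sJB leJs; rewrite -cardsDS // -cards_draws.
rewrite -(card_in_imset (f := fun S => S :\: J)); last first.
  move=> S S'; rewrite !inE => /and3P[_ _ sJS] /and3P[_ _ sJS'] eqD.
  by rewrite -(setID S J) (setIidPr sJS) eqD -{1}(setIidPr sJS') setID.
apply: eq_card => X; apply/imsetP/idP.
  case=> S; rewrite !inE => /and3P[sSB /eqP cS sJS] ->.
  by rewrite setSD //= cardsDS // cS.
rewrite inE => /andP[]; rewrite subsetD => /andP[sXB dXJ] /eqP cX.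
exists (J :|: X); last first.
  rewrite setDUl setDv set0U; apply/setP=> x; rewrite !inE.
  by case: (boolP (x \in X)) => [xX|_]; rewrite ?andbF // (disjointFr dXJ xX).
rewrite inE subUset sJB sXB subsetUl andbT /= cardsU (disjoint_setI0 (_ : [disjoint J & X])) 1?disjoint_sym //.
by rewrite andbT cards0 subn0 cX subnKC.
Qed.
End Slots.

Section Exposure.
Import Order.TTheory GRing.Theory Num.Theory.
Local Open Scope ring_scope.
Variables (F : realFieldType) (n : nat) (p : F).
Hypotheses (p_ge0 : 0 <= p) (p_le1 : p <= 1).
Implicit Types (g : graph n) (u v w : 'I_n) (U A X : {set 'I_n}).

Lemma Pr_nbs w U X : w \notin U -> X \subset U ->
  Pr p (fun g : graph n => nbs g w U == X) =
  p ^+ #|X| * (1 - p) ^+ (#|U| - #|X|).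
Proof.
move=> wU sXU; rewrite (eq_Pr p (fun g => nbs_eq g wU sXU)) Pr_pattern //.
  rewrite !card_star ?cardsDS //; first by rewrite !inE (negbTE wU) andbF.
  by apply: contraNN wU; apply: (subsetP sXU).
rewrite -setI_eq0 star_inter.
- by apply/set0Pn => -[e /starP[u]]; rewrite !inE => /andP[->].
- by apply: contraNN wU; apply: (subsetP sXU).
- by rewrite !inE (negbTE wU) andbF.
Qed.

Lemma Pr_nbs1 w U : w \notin U ->
  Pr p (fun g : graph n => #|nbs g w U| == 1%N) =
  #|U|%:R * p * (1 - p) ^+ #|U|.-1.
Proof.
move=> wU; transitivity (\sum_(u in U) Pr p (fun g : graph n => nbs g w U == [set u])).
  rewrite -(Ex_sum p (mem U) (fun u g => (nbs g w U == [set u])%:R)).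
  apply: eq_Ex => g; case: cards1P => [[u ENu]|nE].
    have uU : u \in U.
      have: u \in nbs g w U by rewrite ENu set11.
      by rewrite inE => /andP[].
    rewrite (bigD1 u) //= ENu eqxx big1 ?addr0 // => v /andP[_ nvu].
    by rewrite (inj_eq set1_inj) eq_sym (negbTE nvu).
  rewrite big1 // => u uU; case: eqP => // ENu; by case: nE; exists u.
rewrite (eq_bigr (fun=> p * (1 - p) ^+ #|U|.-1)) => [|u uU].
  by rewrite sumr_const -[LHS]mulr_natl mulrA.
by rewrite Pr_nbs ?sub1set // cards1 expr1 subn1.
Qed.

End Exposure.

(** * Induced cycles with pendant vertices in a random graph *)

Section InducedCycles.
Variable n : nat.
Implicit Types (g : graph n) (u v w : 'I_n) (U A X D B S : {set 'I_n}) (z c : seq 'I_n).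

(* The newest vertex of the path is the head of the list. *)
Fixpoint ipath g z : bool :=
  if z is w :: z' then
    (if z' is v :: _ then
       (w \notin z') && (nbs g w [set x in z'] == [set v]) else true)
    && ipath g z'
  else true.

(** For empty [z] the two ends coincide and a single edge is accepted; every later use has at least
    three vertices. *)
Definition icycle g c : bool :=
  if c is w :: v :: z then
    [&& w \notin v :: z,
        nbs g w [set x in v :: z] == [set v; last v z] & ipath g (v :: z)]
  else false.

Definition closes g z w : bool :=
  if z is v :: z' then nbs g w [set x in z] == [set v; last v z'] else false.

(** [U] ranges over all small sets instead of the paths found so far, so a union bound applies and
    no conditioning on the growing path is needed. *)
Definition extendable g A L := forall v U,
  v \in U -> U \subset A -> #|U| <= L ->
  exists2 w, w \in A :\: U & nbs g w U = [set v].

Definition pendants g U S : bool :=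
  [forall x in S, #|nbs g x U| == 1] && [disjoint inside S & g].

Lemma ipath_uniq g z : ipath g z -> uniq z.
Proof.
elim: z => [|w [|v z] IHz] // /andP[/andP[wz _] /IHz].
by rewrite [uniq [:: w, _ & _]]cons_uniq wz.
Qed.

Lemma extendable_path g A L : extendable g A L -> A != set0 ->
  forall t, 0 < t <= L -> exists z : t.-tuple 'I_n, ipath g z && all (mem A) z.
Proof.
move=> extA /set0Pn[a aA]; elim=> // -[|t] IHt /andP[_ lt].
  by exists [tuple a]; rewrite /= aA.
have [z /andP[pz /allP zA]] := IHt (ltnW lt).
case/tupleP: z pz zA => v z pz zA.
have [|||w] := extA v [set x in v :: z].
- by rewrite inE mem_head.
- by apply/subsetP=> x; rewrite inE => /zA.
- by rewrite cardsE (leq_trans (card_size _)) //= size_tuple ltnW.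
rewrite 2!inE => /andP[wz wA] Enb.
exists [tuple of w :: v :: z]; rewrite [ipath _ _]/= -/(ipath g (v :: z)) wz pz Enb eqxx /=.
by have /allP /= -> := zA; rewrite wA.
Qed.

Lemma depends_nbs_inside A w z : w \in A -> all (mem A) z ->
  depends (inside A) (fun g => nbs g w [set x in z]).
Proof.
move=> wA zA; have sA : star w [set x in z] \subset inside A.
  apply/subsetP=> e /starP[u]; rewrite inE => /(allP zA) /= uA.
  by rewrite inE => /joins_pairP[] ->; rewrite /= uA wA.
exact: (dependsW sA (@depends_nbs n w _)).
Qed.

Lemma depends_ipath A z : all (mem A) z -> depends (inside A) (fun g => ipath g z).
Proof.
move=> zA g; elim: z zA => [|w z IHz] //= /andP[wA zA]; rewrite IHz //.
by case: z zA {IHz} => // v z zA; rewrite (@depends_nbs_inside A w (v :: z)).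
Qed.

Lemma icycleE g z w : 1 < size z ->
  icycle g (w :: z) = [&& w \notin z, closes g z w & ipath g z].
Proof. by case: z. Qed.
End InducedCycles.

(** * Probability bounds for the path, the cycle and the pendants *)

Section Stages.
Import Order.TTheory GRing.Theory Num.Theory.
Local Open Scope ring_scope.
Variables (F : realFieldType) (n : nat) (p : F).
Hypotheses (p_ge0 : 0 <= p) (p_le1 : p <= 1).
Implicit Types (g : graph n) (u v w : 'I_n) (U A X D B S : {set 'I_n}).

(** Different vertices of [A] look at disjoint stars, so their failures are independent. *)
Lemma Pr_no_extension A U X : [disjoint A & U] -> X \subset U ->
  Pr p (fun g : graph n => [forall w in A, nbs g w U != X]) =
  (1 - p ^+ #|X| * (1 - p) ^+ (#|U| - #|X|)) ^+ #|A|.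
Proof.
move=> dAU sXU; have nU w : w \in A -> w \notin U by move/(disjointFr dAU)->.
rewrite (Pr_forall _ (E_ := fun w => star w U)).
- rewrite -prodr_const; apply: eq_bigr => w /nU wU.
  by rewrite Pr_compl Pr_nbs.
- by move=> w _ g; rewrite depends_nbs.
- by move=> w w' /nU wU /nU wU'; apply: disjoint_star.
Qed.

Lemma Pr_ipath A (L : nat) : (0 < L)%N -> A != set0 ->
  1 - (n ^ L.+1)%:R * (1 - p * (1 - p) ^+ L) ^+ (#|A| - L) <=
  Pr p (fun g => [exists z : L.-tuple 'I_n, ipath g z && all (mem A) z]).
Proof.
move=> L0 A0; pose good g := [exists z : L.-tuple 'I_n, ipath g z && all (mem A) z].
(* Sets are indexed by tuples, repetitions allowed: together with the end vertex there are
   [n ^ L.+1] indices, and sets smaller than [L] are covered as well. *)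
pose bad (x : 'I_n * L.-tuple 'I_n) g :=
  [&& x.1 \in x.2, all (mem A) x.2 &
      [forall w in A :\: [set y in x.2], nbs g w [set y in x.2] != [set x.1]]].
rewrite lerBlDr -lerBlDl -Pr_compl.
apply: le_trans (_ : Pr p (fun g => [exists x, bad x g]) <= _).
  apply: (Pr_mono p_ge0 p_le1) => g; apply: contraR; rewrite negb_exists => /forallP nobad.
  apply/existsP; apply: (extendable_path (L := L)); rewrite ?L0 ?leqnn //.
  move=> v U vU sUA leUL.
  suff /exists_inP[w wA /eqP Ew] : [exists w in A :\: U, nbs g w U == [set v]].
    by exists w.
  rewrite -[X in is_true X]negbK negb_exists_in.
  (* The list of [U] is padded with [v], which already lies in [U], so the tuple has exactly the
     entries of [U]. *)
  pose c := [tuple nth v (enum U) i | i < L].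
  have cU : [set y in c] = U.
    apply/setP=> y; rewrite inE; apply/mapP/idP => [[i _ ->]|yU].
      have [lt|ge] := ltnP i (size (enum U)); last by rewrite nth_default.
      by rewrite -mem_enum mem_nth.
    have ltL : (index y (enum U) < L)%N.
      by apply: leq_trans leUL; rewrite cardE index_mem mem_enum.
    by exists (Ordinal ltL); rewrite ?mem_enum //= nth_index ?mem_enum.
  have := nobad (v, c); rewrite /bad /= cU.
  have -> : v \in c by rewrite -[v \in c]in_set cU.
  have -> // : all (mem A) c.
  by apply/allP=> y yc; apply: (subsetP sUA); rewrite -cU inE.
apply: (le_trans (Pr_union p_ge0 p_le1 bad)).
have -> : (n ^ L.+1)%:R = \sum_(x : 'I_n * L.-tuple 'I_n) 1 :> F.
  by rewrite sumr_const card_prod card_tuple card_ord expnS.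
rewrite mulr_suml; apply: ler_sum => -[v c] _; rewrite mul1r.
have q0 : 0 <= 1 - p by rewrite subr_ge0.
have q1 : 1 - p <= 1 by rewrite gerBl.
have th1 k : p * (1 - p) ^+ k <= 1 by rewrite mulr_ile1 ?exprn_ge0 ?exprn_ile1.
rewrite /bad /=; case: (boolP (v \in c)) => vc; last first.
  by rewrite /= [Pr _ _]big1 ?exprn_ge0 ?subr_ge0 // => g _; rewrite mulr0.
case: (boolP (all (mem A) c)) => cA; last first.
  by rewrite /= [Pr _ _]big1 ?exprn_ge0 ?subr_ge0 // => g _; rewrite mulr0.
rewrite /= Pr_no_extension; first last.
- by rewrite sub1set inE.
- by rewrite -setI_eq0 setIDAC -setIDA setDv setI0.
have cU : (#|[set y in c]| <= L)%N.
  by rewrite cardsE (leq_trans (card_size c)) ?size_tuple.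
rewrite cards1 expr1; apply: le_trans (_ : (1 - p * (1 - p) ^+ L) ^+ #|A :\: [set y in c]| <= _).
  rewrite lerXn2r ?nnegrE ?subr_ge0 // lerD2l lerN2 ler_wpM2l // ler_wiXn2l //.
  by rewrite (leq_trans (leq_subr _ _)).
rewrite ler_wiXn2l ?subr_ge0 ?gerBl ?mulr_ge0 ?exprn_ge0 //.
rewrite cardsD leq_sub2l //; apply: leq_trans cU; apply: subset_leq_card.
exact: subsetIr.
Qed.


Lemma Pr_closes D z : uniq z -> (1 < size z)%N -> [disjoint D & [set x in z]] ->
  Pr p (fun g : graph n => [exists w in D, closes g z w]) =
  1 - (1 - p ^+ 2 * (1 - p) ^+ (size z - 2)) ^+ #|D|.
Proof.
case: z => [|v z] // uz z1 dD.
(* The ends must differ for the closing vertex to have two neighbours; this is the origin of the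
   exponents 2 and [size z - 2]. *)
have zv : v != last v z.
  case: z uz z1 {dD} => // u z /andP[vz _] _.
  by apply: contraNneq vz => -> /=; apply: mem_last.
transitivity (1 - Pr p (fun g : graph n =>
    [forall w in D, nbs g w [set x in v :: z] != [set v; last v z]])).
  by rewrite -Pr_compl; apply: eq_Pr => g; rewrite negb_forall_in;
    apply: eq_existsb => w; rewrite negbK.
rewrite Pr_no_extension // ?cards2 ?zv ?cardsE ?(card_uniqP uz) //.
by apply/subsetP=> x; rewrite !inE => /orP[]/eqP->; rewrite ?eqxx // -in_cons mem_last.
Qed.

(** The path depends on the slots inside [A] only, and closing it on slots with an end in [D]; by
    two rounds of exposure the two bounds multiply. *)
Lemma Pr_icycle A D (L : nat) : (1 < L)%N -> A != set0 -> [disjoint A & D] ->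
  (1 - (n ^ L.+1)%:R * (1 - p * (1 - p) ^+ L) ^+ (#|A| - L)) *
  (1 - (1 - p ^+ 2 * (1 - p) ^+ (L - 2)) ^+ #|D|) <=
  Pr p (fun g => [exists c : L.+1.-tuple 'I_n, icycle g c && all (mem (A :|: D)) c]).
Proof.
move=> L1 A0 dAD; set a := (1 - _ ^+ #|D|).
have p1 : 0 <= 1 - p by rewrite subr_ge0.
have a0 : 0 <= a.
  rewrite subr_ge0 exprn_ile1 ?subr_ge0 ?mulr_ile1 ?exprn_ge0 ?exprn_ile1 ?gerBl //.
  by rewrite mulr_ge0 ?exprn_ge0.
apply: le_trans (ler_wpM2r a0 (Pr_ipath (ltnW L1) A0)) _.
pose V (z : L.-tuple 'I_n) := uniq z && all (mem A) z.
have dDz (z : L.-tuple 'I_n) : V z -> [disjoint D & [set x in z]].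
  case/andP=> _ /allP zA; apply/pred0P=> x /=; rewrite inE; apply/andP=> -[xD /zA /= xA].
  by rewrite (disjointFr dAD xA) in xD.
apply: le_trans (Pr_two_rounds p_ge0 p_le1 (E := inside A) (E' := ~: inside A) (V := V)
  (P_ := fun (z : L.-tuple 'I_n) g => ipath g z && all (mem A) z)
  (Q_ := fun (z : L.-tuple 'I_n) g => [exists w in D, closes g z w]) _ _ _ _ _) _.
- move=> z g; case: (boolP (all (mem A) z)) => zA; last by rewrite !andbF.
  by rewrite (depends_ipath zA).
- move=> z Vz g; apply: eq_existsb => w; case: (boolP (w \in D)) => //= wD.
  rewrite /closes; case: (tval z) => [|v z'] //=.
  by rewrite (@depends_nbs_outside _ w A [set x in v :: z']) ?(disjointFl dAD).
- by rewrite -setI_eq0 setICr.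
- by move=> z g /andP[/ipath_uniq uz zA]; rewrite /V uz.
- move=> z Vz; rewrite Pr_closes ?dDz ?size_tuple //; by case/andP: Vz.
apply: (Pr_mono p_ge0 p_le1) => g /existsP[z /andP[/andP[pz zA] /exists_inP[w wD cw]]].
have Vz : V z by rewrite /V (ipath_uniq pz).
apply/existsP; exists [tuple of w :: z]; rewrite icycleE ?size_tuple //.
rewrite cw pz /= !inE wD orbT /= andbT.
have := disjointFr (dDz z Vz) wD; rewrite inE => -> /=.
by apply: sub_all zA => x /= xA; rewrite inE xA.
Qed.

Lemma sum_subsets (T : finType) (S : {set T}) (G : nat -> F) :
  \sum_(J : {set T} | (J \subset S) && (J != set0)) G #|J| =
  \sum_(1 <= j < #|S|.+1) 'C(#|S|, j)%:R * G j.
Proof.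
have cJ (J : {set T}) : J \subset S -> (#|J| < #|S|.+1)%N.
  by rewrite ltnS => /subset_leq_card.
rewrite big_geq_mkord /=.
rewrite (partition_big (fun J : {set T} => inord #|J| : 'I_#|S|.+1)
  (fun j : 'I_#|S|.+1 => (0 < j)%N)) /= => [|J /andP[sJS J0]]; last first.
  by rewrite inordK ?cJ // card_gt0.
apply: eq_bigr => j j0.
rewrite -cards_draws mulr_natl -sumr_const; apply: eq_big => [J|J].
  rewrite inE; case: (boolP (J \subset S)) => //= sJS.
  rewrite -(inj_eq (@ord_inj _)) inordK ?cJ //; case: (#|J| =P j) => [cJj|_]; last by rewrite andbF.
  by rewrite andbT -card_gt0 cJj.
by case/andP=> /andP[sJS _] /eqP <-; rewrite inordK ?cJ.
Qed.

(** The quotient of the binomials is the product of [(s - i) / (m - i)] over [i < j], and since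
    [s <= m] each factor is at most [s / m]. *)
Lemma bin_sub_le (m s j : nat) : (j <= s)%N -> (s <= m)%N -> (0 < m)%N ->
  'C(m - j, s - j)%:R <= 'C(m, s)%:R * (s%:R / m%:R) ^+ j :> F.
Proof.
elim: j m s => [|j IHj] m s js sm m0; first by rewrite !subn0 expr0 mulr1.
case: s m js sm m0 => // s [|m] // js sm m0; rewrite !subSS.
have Cms : 'C(m, s)%:R = 'C(m.+1, s.+1)%:R * (s.+1%:R / m.+1%:R) :> F.
  rewrite mulrA; apply: (canRL (mulfK _)); rewrite ?pnatr_eq0 // -!natrM.
  by rewrite mulnC -[m in 'C(m, _)]/(m.+1.-1) mul_bin_diag mulnC.
have [m00|m0'] := posnP m.
  move: js sm; rewrite m00 !ltnS leqn0 => js /eqP s0; move: js; rewrite s0 leqn0 => /eqP->.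
  by rewrite !bin1 expr1 divff ?mulr1 ?pnatr_eq0.
apply: le_trans (IHj m s js sm m0') _; rewrite exprS mulrA -Cms.
apply: ler_wpM2l; first exact: ler0n.
rewrite lerXn2r ?nnegrE ?divr_ge0 ?ler0n //.
rewrite ler_pdivrMr ?ltr0n // mulrAC ler_pdivlMr ?ltr0n // -!natrM ler_nat.
by rewrite mulnS mulSn leq_add2r.
Qed.

(** Second moment over the [s]-subsets of [B]. Two of them that share [j] vertices are correlated by
    the factor [1 / w j], and a fixed set of [j] vertices lies in a proportion of at most
    [(s / #|B|) ^ j] of the subsets. *)
Lemma Pr_pendants U B (s : nat) (q := #|U|%:R * p * (1 - p) ^+ #|U|.-1) :
  [disjoint U & B] -> 0 < q -> p < 1 -> (0 < #|B|)%N -> (s <= #|B|)%N ->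
  (1 + \sum_(1 <= j < s.+1) 'C(s, j)%:R *
     ((s%:R / #|B|%:R) ^+ j * (q ^+ j * (1 - p) ^+ 'C(j, 2))^-1))^-1 <=
  Pr p (fun g => [exists S : {set 'I_n}, (S \subset B) && (#|S| == s) && pendants g U S]).
Proof.
move=> dUB q0 p1 B0 sB; set beta := \sum_(1 <= j < _) _.
have p1' : 0 < 1 - p by rewrite subr_gt0.
(* The probability that a given set of [j] vertices of [B] is admissible. *)
pose w j := q ^+ j * (1 - p) ^+ 'C(j, 2).
have w0 j : 0 < w j by rewrite mulr_gt0 ?exprn_gt0.
(* Since [inside] commutes with intersections, inclusion-exclusion holds for the vertices and for
   the slots within them, so the exponents of union and intersection add up to those of [S] and
   [S']. *)
have PrI S S' : S \subset B -> S' \subset B ->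
    Pr p (fun g => pendants g U S && pendants g U S') * w #|S :&: S'| = w #|S| * w #|S'|.
  move=> sSB sSB'; have sUB : S :|: S' \subset B by rewrite subUset sSB.
  have memB x : x \in S :|: S' -> x \in B by apply: (subsetP sUB).
  have nU x : x \in B -> x \notin U by move=> xB; rewrite (disjointFl dUB xB).
  transitivity (q ^+ #|S :|: S'| * (1 - p) ^+ #|inside S :|: inside S'| * w #|S :&: S'|).
    congr (_ * _).
    transitivity (Pr p (fun g : graph n => [forall x in S :|: S', #|nbs g x U| == 1%N] &&
      [disjoint inside S :|: inside S' & g])).
      apply: eq_Pr => g; rewrite /pendants andbACA.
      rewrite -!setI_eq0 setIUl setU_eq0; congr (_ && _).
      apply/andP/forall_inP => [[/forall_inP a /forall_inP b] x|a].
        by rewrite inE => /orP[/a|/b].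
      by split; apply/forall_inP => x xS; apply: a; rewrite inE xS ?orbT.
    rewrite (Pr_forall_and _ (E_ := fun x => star x U) (E := inside S :|: inside S')).
    - congr (_ * _).
        rewrite -prodr_const; apply: eq_bigr => x /memB/nU xU; exact: Pr_nbs1.
      have := Pr_pattern p (A := set0) (B := inside S :|: inside S').
      rewrite cards0 expr0 mul1r => <-; first by apply: eq_Pr => g; rewrite sub0set.
      by rewrite -setI_eq0 set0I.
    - by move=> x _ g; rewrite depends_nbs.
    - move=> g; rewrite -!setI_eq0; congr (_ == _).
      by rewrite setIC -setIA setIid setIC.
    - move=> x /memB xB; rewrite -setI_eq0 setIUr setU_eq0 !setI_eq0.
      by rewrite !disjoint_star_inside_set //; [apply: disjointWr dUB | apply: disjointWr dUB].
    - by move=> x y /memB/nU xU /memB/nU yU; apply: disjoint_star.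
  rewrite mulrACA -!exprD cardsUI -!card_inside -inside_inter cardsUI !exprD.
  by rewrite mulrACA !card_inside.
have PrS S : S \subset B -> Pr p (fun g => pendants g U S) = w #|S|.
  move=> sSB; have := PrI S S sSB sSB; rewrite setIid => /(mulIf _) <-.
    by apply: eq_Pr => g; rewrite andbb.
  by rewrite gt_eqF.
pose D := [pred S : {set 'I_n} | (S \subset B) && (#|S| == s)].
have cD : \sum_(S | D S) 1 = 'C(#|B|, s)%:R :> F.
  rewrite -cards_draws sumr_const; congr (_%:R); apply: eq_card => S.
  by rewrite !inE.
pose M := 'C(#|B|, s)%:R * w s.
have M0 : 0 < M by rewrite mulr_gt0 // ltr0n bin_gt0.
have beta0 : 0 <= beta.
  apply: sumr_ge0 => j _; rewrite mulr_ge0 ?mulr_ge0 ?ler0n ?exprn_ge0 ?divr_ge0 ?ler0n //.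
  by rewrite invr_ge0 ltW ?w0.
apply: (second_moment p_ge0 p_le1 (D := D) M0); first by rewrite ltr_wpDr.
  rewrite /M -cD mulr_suml; apply: eq_bigr => S /andP[sSB /eqP <-].
  by rewrite mul1r PrS.
have superS S : D S -> \sum_(S' | D S') (w #|S :&: S'|)^-1 <= 'C(#|B|, s)%:R * (1 + beta).
  case/andP=> sSB /eqP cS.
  (* Only the term [J = S :&: S'] is wanted. Adding those of all other nonempty subsets of [S]
     replaces an exact intersection by the containment [J \subset S'], which a single binomial
     counts. *)
  apply: le_trans (_ : \sum_(S' | D S') (1 +
     \sum_(J : {set 'I_n} | (J \subset S) && (J != set0)) (J \subset S')%:R * (w #|J|)^-1) <= _).
    apply: ler_sum => S' _; have t0 J : 0 <= (J \subset S')%:R * (w #|J|)^-1.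
      by rewrite mulr_ge0 ?ler0n ?invr_ge0 ?ltW.
    have [->|I0] := eqVneq (S :&: S') set0.
      by rewrite cards0 /w !expr0 mulr1 invr1 lerDl sumr_ge0.
    rewrite (bigD1 (S :&: S')) ?subsetIl //= subsetIr mul1r addrCA lerDl.
    by rewrite addr_ge0 ?sumr_ge0.
  rewrite big_split /= cD mulrDr mulr1 lerD2l exchange_big /=.
  apply: le_trans (_ : \sum_(J : {set 'I_n} | (J \subset S) && (J != set0))
     'C(#|B|, s)%:R * ((s%:R / #|B|%:R) ^+ #|J| * (w #|J|)^-1) <= _); last first.
    by rewrite -mulr_sumr (sum_subsets S (fun j => (s%:R / #|B|%:R) ^+ j * (w j)^-1)) cS.
  apply: ler_sum => J /andP[sJS _]; rewrite -mulr_suml mulrA ler_wpM2r ?invr_ge0 ?(ltW (w0 _)) //.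
  have -> : \sum_(S' | D S') (J \subset S')%:R = 'C(#|B| - #|J|, s - #|J|)%:R :> F.
    rewrite -card_supersets ?(subset_trans sJS) // -?cS ?subset_leq_card // cS.
    rewrite -sum1_card natr_sum big_mkcond [RHS]big_mkcond /=; apply: eq_bigr => S' _.
    by rewrite !inE andbA; case: (_ && _); case: (J \subset S').
  by apply: bin_sub_le => //; rewrite -cS subset_leq_card.
apply: le_trans (_ : \sum_(S | D S) w s ^+ 2 * ('C(#|B|, s)%:R * (1 + beta)) <= _).
  apply: ler_sum => S DS; apply: le_trans (ler_wpM2l _ (superS S DS)); last by rewrite exprn_ge0 ?ltW.
  rewrite mulr_sumr; apply: ler_sum => S' DS'.
  case/andP: DS => sSB /eqP cS; case/andP: DS' => sSB' /eqP cS'.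
  by rewrite ler_pdivlMr // PrI // cS cS' expr2.
rewrite sumr_const -[X in X <= _]mulr_natl.
have -> : #|D| = 'C(#|B|, s).
  by rewrite -cards_draws; apply: eq_card => S; rewrite !inE.
rewrite /M exprMn le_eqVlt; apply/orP; left; apply/eqP.
by rewrite [LHS]mulrCA [X in _ * X = _]mulrA -expr2 [LHS]mulrC [_ ^+ 2 * (1 + _)]mulrC -mulrA /w !exprMn.
Qed.

Lemma depends_icycle A c : all (mem A) c -> depends (inside A) (fun g => icycle g c).
Proof.
case: c => [|w [|v z]] // /andP[wA zA] g; rewrite /icycle.
by rewrite (@depends_nbs_inside _ A w (v :: z)) ?(@depends_ipath _ A (v :: z)).
Qed.

Lemma icycle_uniq g c : icycle g c -> uniq c.
Proof.
by case: c => [|w [|v z]] // /and3P[wz _ /ipath_uniq uz]; rewrite cons_uniq wz.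
Qed.

(** The cycle is read off from the slots inside [A :|: D], while every slot examined by [pendants]
    has an end in [B]. The third bound depends only on the length of the cycle, hence it multiplies
    the other two. *)
Lemma Pr_icycle_pendants A D B (L s : nat) (q := L.+1%:R * p * (1 - p) ^+ L) :
  0 < p -> p < 1 -> [disjoint A & D] -> [disjoint A :|: D & B] ->
  (1 < L)%N -> A != set0 -> (0 < #|B|)%N -> (s <= #|B|)%N ->
  (1 - (n ^ L.+1)%:R * (1 - p * (1 - p) ^+ L) ^+ (#|A| - L)) *
  (1 - (1 - p ^+ 2 * (1 - p) ^+ (L - 2)) ^+ #|D|) *
  (1 + \sum_(1 <= j < s.+1) 'C(s, j)%:R *
     ((s%:R / #|B|%:R) ^+ j * (q ^+ j * (1 - p) ^+ 'C(j, 2))^-1))^-1 <=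
  Pr p (fun g => [exists c : L.+1.-tuple 'I_n, (icycle g c && all (mem (A :|: D)) c) &&
    [exists S : {set 'I_n}, (S \subset B) && (#|S| == s) && pendants g [set x in c] S]]).
Proof.
move=> p0 p1 dAD dAB L1 A0 B0 sB; set b := _^-1.
have q0 : 0 < q by rewrite !mulr_gt0 ?ltr0n // exprn_gt0 // subr_gt0.
have b0 : 0 <= b.
  rewrite invr_ge0 addr_ge0 // sumr_ge0 // => j _.
  rewrite mulr_ge0 ?mulr_ge0 ?ler0n ?exprn_ge0 ?divr_ge0 ?ler0n //.
  by rewrite invr_ge0 mulr_ge0 ?exprn_ge0 ?subr_ge0 // ltW.
apply: le_trans (ler_wpM2r b0 (Pr_icycle L1 A0 dAD)) _.
pose V (c : L.+1.-tuple 'I_n) := uniq c && all (mem (A :|: D)) c.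
have dcB (c : L.+1.-tuple 'I_n) : V c -> [disjoint [set x in c] & B].
  case/andP=> _ /allP cAD; apply: disjointWl dAB.
  by apply/subsetP=> x; rewrite inE => /cAD.
apply: (Pr_two_rounds p_ge0 p_le1 (E := inside (A :|: D)) (E' := ~: inside (A :|: D)) (V := V)
  (P_ := fun (c : L.+1.-tuple 'I_n) g => icycle g c && all (mem (A :|: D)) c)
  (Q_ := fun (c : L.+1.-tuple 'I_n) g => [exists S : {set 'I_n},
     (S \subset B) && (#|S| == s) && pendants g [set x in c] S])).
- move=> c g; case: (boolP (all _ c)) => cA; last by rewrite !andbF.
  by rewrite (depends_icycle cA).
- move=> c Vc g; apply: eq_existsb => S; case: (boolP (S \subset B)) => //= sSB.
  congr (_ && _).
  have nAD x : x \in S -> x \notin A :|: D.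
    by move=> xS; rewrite (disjointFl dAB) // (subsetP sSB).
  rewrite /pendants; congr (_ && _).
    apply: eq_forallb => x; case: (boolP (x \in S)) => //= xS.
    by rewrite (@depends_nbs_outside _ x _ [set y in c] (nAD x xS)).
  rewrite -!setI_eq0; congr (_ == _); apply/setP=> e; rewrite !in_setI in_setC.
  case: (boolP (e \in inside S)) => //=; rewrite !inE => /andP[/nAD e1 _].
  by move: e1; rewrite inE => /negbTE ->; rewrite andbT.
- by rewrite -setI_eq0 setICr.
- by move=> c g /andP[/icycle_uniq uc cA]; rewrite /V uc.
move=> c Vc; have cc : #|[set x in c]| = L.+1.
  by rewrite cardsE; case/andP: Vc => /card_uniqP-> _; rewrite size_tuple.
by have := Pr_pendants (U := [set x in c]) (dcB c Vc); rewrite cc; apply.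
Qed.
End Stages.

From mathcomp Require Import Rstruct.
From Stdlib Require Import Reals Lra Lia.

(** * Planar embedding of an odd cycle with pendant vertices *)

Section PlaneEmbedding.
Local Open Scope R_scope.

Lemma cos_lipschitz x y : Rabs (cos x - cos y) <= Rabs (x - y).
Proof.
have [z [-> _]] := MVT_abs cos (fun z => - sin z) y x (fun z _ => derivable_pt_lim_cos z).
have := SIN_bound z => bz; have : Rabs (- sin z) <= 1 by apply: Rabs_le; lra.
by move=> h; rewrite -[X in _ <= X]Rmult_1_l; apply: Rmult_le_compat_r => //; apply: Rabs_pos.
Qed.

(* Consecutive vertices of a cycle of odd length L sit at consecutive angles
   differing by pi + pi / L, so that they are the farthest vertices of the
   regular L-gon. *)
Definition cycle_angle (L i : nat) : R := PI * INR i + PI * INR i / INR L.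

Definition sqdist (u v : R * R) : R := Rsqr (u.1 - v.1) + Rsqr (u.2 - v.2).

Definition cycle_pt (L i : nat) : R * R := (cos (cycle_angle L i), sin (cycle_angle L i)).

(* A point of the arc of radius D around the i-th vertex, at angle t from the
   middle of the arc. *)
Definition pendant_pt (L : nat) (D : R) (i : nat) (t : R) : R * R :=
  (cos (cycle_angle L i) - D * cos (cycle_angle L i + t),
   sin (cycle_angle L i) - D * sin (cycle_angle L i + t)).

Lemma sqdist_sym u v : sqdist u v = sqdist v u.
Proof. by rewrite /sqdist /Rsqr; ring. Qed.

Lemma sqdist_cycle L i j :
  sqdist (cycle_pt L i) (cycle_pt L j) =
  2 - 2 * cos (cycle_angle L i - cycle_angle L j).
Proof.
rewrite /sqdist /= cos_minus.
have := sin2_cos2 (cycle_angle L i); have := sin2_cos2 (cycle_angle L j).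
by rewrite /Rsqr; lra.
Qed.

Lemma sqdist_pendant_cycle L D i t j :
  let g := cycle_angle L i - cycle_angle L j in
  sqdist (pendant_pt L D i t) (cycle_pt L j) =
  2 - 2 * cos g + D * D - 2 * D * (cos t - cos (g + t)).
Proof.
move=> g; rewrite /sqdist /=.
have -> : g + t = (cycle_angle L i + t) - cycle_angle L j by rewrite /g; ring.
have -> : cos t = cos ((cycle_angle L i + t) - cycle_angle L i).
  by congr cos; ring.
rewrite /g; set a := cycle_angle L i; set b := cycle_angle L j; set c := a + t.
rewrite !cos_minus.
have ha := sin2_cos2 a; have hb := sin2_cos2 b; have hc := sin2_cos2 c.
have hcD : D * D * (Rsqr (sin c) + Rsqr (cos c)) = D * D by rewrite hc; ring.
by move: ha hb hcD; rewrite /Rsqr; lra.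
Qed.

Lemma sqdist_pendant L D i t j t' :
  let g := cycle_angle L i - cycle_angle L j in
  sqdist (pendant_pt L D i t) (pendant_pt L D j t') =
  2 - 2 * cos g + D * D * (2 - 2 * cos (g + t - t')) -
  2 * D * (cos t + cos t' - cos (g - t') - cos (g + t)).
Proof.
move=> g; rewrite /sqdist /=.
have -> : g + t - t' = (cycle_angle L i + t) - (cycle_angle L j + t') by rewrite /g; ring.
have -> : g + t = (cycle_angle L i + t) - cycle_angle L j by rewrite /g; ring.
have -> : g - t' = cycle_angle L i - (cycle_angle L j + t') by rewrite /g; ring.
have -> : cos t = cos ((cycle_angle L i + t) - cycle_angle L i).
  by congr cos; ring.
have -> : cos t' = cos ((cycle_angle L j + t') - cycle_angle L j).
  by congr cos; ring.
rewrite /g; set a := cycle_angle L i; set b := cycle_angle L j.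
set c := a + t; set d := b + t'.
rewrite !cos_minus.
have ha := sin2_cos2 a; have hb := sin2_cos2 b.
have hcD : D * D * (Rsqr (sin c) + Rsqr (cos c)) = D * D by rewrite sin2_cos2; ring.
have hdD : D * D * (Rsqr (sin d) + Rsqr (cos d)) = D * D by rewrite sin2_cos2; ring.
by move: ha hb hcD hdD; rewrite /Rsqr; lra.
Qed.

Lemma cos_PI_mul k x : cos (PI * INR k + x) = (if odd k then -1 else 1) * cos x.
Proof.
elim: k => [|k IHk]; first by rewrite /= Rmult_0_r Rplus_0_l Rmult_1_l.
have -> : PI * INR k.+1 + x = (PI * INR k + x) + PI by rewrite S_INR; ring.
by rewrite neg_cos IHk [odd k.+1]/=; case: (odd k) => /=; ring.
Qed.

Section Angles.
Variables (L : nat).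
Hypotheses (L_odd : odd L) (L_gt1 : (1 < L)%nat).
(** The radii to two farthest vertices of the regular polygon form an angle with cosine [- kappa],
    so the squared diameter is [2 + 2 * kappa]. *)
Let kappa := cos (PI / INR L).

Let L3 : 3 <= INR L.
Proof.
have : (3 <= L)%nat by case: L L_odd L_gt1 => [|[|[|]]].
by move=> /leP h; have := le_INR _ _ h; rewrite /=; lra.
Qed.

Lemma kappa_bounds : 0 < kappa < 1.
Proof.
have pi0 := PI_RGT_0; have := L3 => h3.
have a0 : 0 < PI / INR L by apply: Rdiv_lt_0_compat; lra.
have a1 : PI / INR L < PI / 2.
  apply: Rmult_lt_compat_l => //; apply: Rinv_lt_contravar; lra.
split; first by apply: cos_gt_0; lra.
by rewrite -cos_0; apply: cos_decreasing_1; lra.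
Qed.

(** Cosine is strictly decreasing on [0, pi], so the extremes occur only at [d = 1] and
    [d = L - 1]. *)
Lemma cos_multiple_le d : (0 < d < L)%nat ->
  - kappa <= cos (PI * INR d / INR L) <= kappa /\
  (d <> 1%nat -> cos (PI * INR d / INR L) < kappa) /\
  (d <> L.-1 -> - kappa < cos (PI * INR d / INR L)).
Proof.
case/andP=> /ltP d0 /ltP dL; have pi0 := PI_RGT_0; have := L3 => h3.
have d1 : 1 <= INR d by have := le_INR _ _ d0.
have dL1 : INR d <= INR L - 1.
  by have := le_INR _ _ dL; rewrite S_INR; lra.
have mono x y : 0 <= x -> x < y -> y <= INR L -> cos (PI * y / INR L) < cos (PI * x / INR L).
  move=> x0 xy yL; have iL : 0 < / INR L by apply: Rinv_0_lt_compat; lra.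
  have b z : 0 <= z -> z <= INR L -> 0 <= PI * z / INR L <= PI.
    move=> z0 zL; split; first by apply: Rmult_le_pos; [apply: Rmult_le_pos|]; lra.
    have -> : PI * z / INR L = PI - PI * (INR L - z) * / INR L by field; lra.
    have : 0 <= PI * (INR L - z) * / INR L by apply: Rmult_le_pos; [apply: Rmult_le_pos|]; lra.
    lra.
  have [? ?] := b x x0 ltac:(lra); have [? ?] := b y ltac:(lra) yL.
  apply: cos_decreasing_1 => //.
  apply: Rmult_lt_compat_r => //; exact: Rmult_lt_compat_l.
have k1 : kappa = cos (PI * 1 / INR L) by rewrite Rmult_1_r.
have k2 : - kappa = cos (PI * (INR L - 1) / INR L).
  have -> : PI * (INR L - 1) / INR L = - (PI / INR L) + PI by field; lra.
  by rewrite neg_cos cos_neg.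
have u : d <> 1%nat -> cos (PI * INR d / INR L) < kappa.
  move=> nd; rewrite k1; apply: mono; try lra.
  have : (1 < d)%coq_nat by lia.
  by move/lt_INR.
have l : d <> L.-1 -> - kappa < cos (PI * INR d / INR L).
  move=> nd; rewrite k2; apply: mono; try lra.
  have dd : (d.+1 < L)%coq_nat by move: nd; case: (L) dL => /= *; lia.
  by have := lt_INR _ _ dd; rewrite S_INR; lra.
split; last by [].
split.
  case: (PeanoNat.Nat.eq_dec d L.-1) => [e|/l]; last lra.
  have LE : L = d.+1 by rewrite e; case: (L) dL => //=; lia.
  by rewrite k2; have -> : INR d = INR L - 1; [rewrite LE S_INR; ring | lra].
case: (PeanoNat.Nat.eq_dec d 1%nat) => [->|/u]; last lra.
by rewrite k1 /=; lra.
Qed.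

Definition cyclically_adjacent (i j : nat) := (j == i.+1) || ((i == 0%nat) && (j == L.-1)).

(** With [d = j - i] the cosine is that of [PI * d / L], negated when [d] is odd. Hence [- kappa] is
    attained by an odd [d] only at 1 and by an even [d] only at [L - 1], which is even because [L]
    is odd. *)
Lemma cos_cycle_angle i j : (i < j)%nat -> (j < L)%nat ->
  let x := cos (cycle_angle L i - cycle_angle L j) in
  - kappa <= x <= kappa /\ (cyclically_adjacent i j <-> x = - kappa).
Proof.
move=> ij jL; pose d := (j - i)%nat.
have jE : j = (d + i)%nat by rewrite /d subnK // ltnW.
have d0 : (0 < d < L)%nat by rewrite subn_gt0 ij (leq_ltn_trans (leq_subr _ _)).
have h3 := L3.
rewrite /= -cos_neg.
have -> : - (cycle_angle L i - cycle_angle L j) = PI * INR d + PI * INR d / INR L.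
  by rewrite jE /cycle_angle plus_INR; field; lra.
have -> : cyclically_adjacent i j = (d == 1%nat) || (d == L.-1).
  rewrite /cyclically_adjacent jE -add1n eqn_add2r; case: eqVneq => //= nd1.
  apply/andP/eqP => [[/eqP-> /eqP]|dE]; first by rewrite addn0.
  have i0 : i = 0%nat.
    move: jL; rewrite jE dE; case: (L) L_gt1 => // l _ /=.
    by rewrite -[X in (_ < X)%nat]add1n addnC ltn_add2r ltnS leqn0 => /eqP.
  by rewrite i0 addn0 dE !eqxx.
rewrite cos_PI_mul; have [b [u l]] := cos_multiple_le d0; have [k0 k1] := kappa_bounds.
have Lm1 : ~~ odd L.-1 by case: (L) L_odd.
case: (boolP (odd d)) => od; split; try lra.
  have nd : d <> L.-1 by move=> e; move: Lm1; rewrite -e od.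
  split=> [/orP[/eqP->|/eqP//]|e]; first by rewrite /kappa /= Rmult_1_r; ring.
  case: (PeanoNat.Nat.eq_dec d 1%nat) => [->//|/u]; lra.
have nd : d <> 1%nat by move=> e; move: od; rewrite e.
have -> : (d == 1%nat) = false by apply/eqP.
split=> [/eqP e|e] /=; last first.
  by apply/eqP; case: (PeanoNat.Nat.eq_dec d L.-1) => // /l; lra.
have LE : INR d = INR L - 1.
  by rewrite e; case: (L) L_gt1 => // l' _; rewrite S_INR /=; ring.
have -> : PI * INR d / INR L = - (PI / INR L) + PI by rewrite LE; field; lra.
by rewrite neg_cos cos_neg /kappa; ring.
Qed.


Definition width := sqrt (2 + 2 * kappa).

Lemma width_sqr : width * width = 2 + 2 * kappa.
Proof. by apply: sqrt_sqrt; have := kappa_bounds; lra. Qed.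

Lemma width_bounds : 1 < width < 2.
Proof.
have [k0 k1] := kappa_bounds; have w2 := width_sqr.
have w0 : 0 <= width by apply: sqrt_pos.
split; nra.
Qed.

Lemma cos_cycle_angle_neq i j : i <> j -> (i < L)%nat -> (j < L)%nat ->
  - kappa <= cos (cycle_angle L i - cycle_angle L j) <= kappa.
Proof.
move=> /eqP; rewrite neq_ltn => /orP[ij iL jL|ji iL jL].
  by have [] := cos_cycle_angle ij jL.
rewrite -cos_neg Ropp_minus_distr; by have [] := cos_cycle_angle ji iL.
Qed.

Lemma cos_shift x t eta : 0 <= t <= eta -> Rabs (cos (x + t) - cos x) <= eta.
Proof.
move=> ht; apply: Rle_trans (cos_lipschitz _ _) _.
by have -> : x + t - x = t by [ring]; rewrite Rabs_pos_eq; lra.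
Qed.

(* At angle 0 the pendants form a copy of the cycle scaled by 1 - width, where
   the inequalities are strict; they persist for small angles by continuity. *)
Lemma pendant_separation : exists2 eta, 0 < eta & forall i t, (i < L)%nat -> 0 <= t <= eta ->
  sqdist (pendant_pt L width i t) (cycle_pt L i) = width * width /\
  (forall j, (j < L)%nat -> i <> j ->
    0 < sqdist (pendant_pt L width i t) (cycle_pt L j) < width * width) /\
  (forall j t', (j < L)%nat -> 0 <= t' <= eta -> (i, t) <> (j, t') ->
    0 < sqdist (pendant_pt L width i t) (pendant_pt L width j t') < width * width).
Proof.
have [k0 k1] := kappa_bounds; have w2 := width_sqr; have [w1 w2'] := width_bounds.
set D := width in w2 w1 w2' *; set k := kappa in k0 k1 w2 *.
(* Gaps at angle 0: [e1] and [e3] keep squared distances away from 0, [e2] and [e4] keep them below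
   [D * D]. The first two concern a pendant and another cycle vertex, the last two the pendants of
   different cycle vertices. *)
pose e1 := (2 - D) * (2 - D); pose e2 := 2 * (D - 1) * (1 - k).
pose e3 := (D - 1) * (D - 1) * (2 * (1 - k)); pose e4 := D * D * (D * (2 - D)).
have p1 : 0 < e1 by apply: Rmult_lt_0_compat; lra.
have p2 : 0 < e2 by apply: Rmult_lt_0_compat; lra.
have p3 : 0 < e3 by apply: Rmult_lt_0_compat; nra.
have p4 : 0 < e4 by apply: Rmult_lt_0_compat; nra.
pose e := Rmin (Rmin e1 e2) (Rmin (Rmin e3 e4) 1).
have pe : 0 < e by repeat apply: Rmin_glb_lt => //; lra.
have [q1 [q2 [q3 [q4 q5]]]] : e <= e1 /\ e <= e2 /\ e <= e3 /\ e <= e4 /\ e <= 1.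
  have := Rmin_l (Rmin e1 e2) (Rmin (Rmin e3 e4) 1); have := Rmin_r (Rmin e1 e2) (Rmin (Rmin e3 e4) 1).
  have := Rmin_l e1 e2; have := Rmin_r e1 e2; have := Rmin_l (Rmin e3 e4) 1.
  have := Rmin_r (Rmin e3 e4) 1; have := Rmin_l e3 e4; have := Rmin_r e3 e4.
  by rewrite -/e => *; repeat split; lra.
(* In the worst case, two pendants, both brackets of cosines move by at most [e / 16] and have
   coefficients at most 4, so the total error [e / 2] stays below every gap. *)
exists (e / 64); first lra.
move=> i t iL ht; split.
  rewrite sqdist_pendant_cycle /= Rminus_diag Rplus_0_l cos_0; lra.
have bt := cos_shift 0 ht; rewrite Rplus_0_l cos_0 in bt.
have {bt} [bt1 bt2] : - (e / 64) <= cos t - 1 <= e / 64.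
  by move: bt; rewrite /Rabs; case: Rcase_abs; lra.
have shift x s : 0 <= s <= e / 64 -> - (e / 64) <= cos (x + s) - cos x <= e / 64.
  by move=> hs; have := cos_shift x hs; rewrite /Rabs; case: Rcase_abs; lra.
have scale D' x y m : 0 <= D' <= 4 -> - m <= x - y <= m -> D' * y - 4 * m <= D' * x <= D' * y + 4 * m.
  by move=> hD hx; split; nra.
split=> [j jL ij|j t' jL ht' ijt].
  rewrite sqdist_pendant_cycle /=; set a := cycle_angle L i - cycle_angle L j.
  have [c1 c2] := cos_cycle_angle_neq ij iL jL; rewrite -/a -/k in c1 c2.
  have := shift a t ht => ha.
  have s1 : - (e / 32) <= (cos t - cos (a + t)) - (1 - cos a) <= e / 32 by lra.
  have D4 : 0 <= 2 * D <= 4 by lra.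
  have := scale _ _ _ _ D4 s1 => s2.
  have g1 : e1 <= 2 - 2 * cos a + D * D - 2 * D * (1 - cos a) by rewrite /e1; nra.
  have g2 : 2 - 2 * cos a + D * D - 2 * D * (1 - cos a) <= D * D - e2 by rewrite /e2; nra.
  lra.
(* Pendants of the same cycle vertex lie on one arc of radius [D]. Their distance is below [D] as
   long as the angle between them is less than pi / 3, and the bound 1 in [e] ensures this. *)
case: (PeanoNat.Nat.eq_dec i j) => [eij|ij].
  subst j; have tt' : t <> t' by move=> tt'; apply: ijt; rewrite tt'.
  rewrite sqdist_pendant /= Rminus_diag cos_0.
  have -> : 0 + t - t' = t - t' by ring.
  have -> : 0 - t' = - t' by ring.
  rewrite Rplus_0_l cos_neg.
  have lt1 : cos (t - t') < 1.
    have [lt|gt] := Rdichotomy _ _ tt'.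
      rewrite -cos_neg Ropp_minus_distr -cos_0; apply: cos_decreasing_1; have := PI2_1; lra.
    rewrite -cos_0; apply: cos_decreasing_1; have := PI2_1; lra.
  have gt2 : 1 / 2 < cos (t - t').
    have := cos_lipschitz (t - t') 0; rewrite cos_0 Rminus_0_r.
    by rewrite /Rabs; case: Rcase_abs; case: Rcase_abs; lra.
  by split; nra.
rewrite sqdist_pendant /=; set a := cycle_angle L i - cycle_angle L j.
have [c1 c2] := cos_cycle_angle_neq ij iL jL; rewrite -/a -/k in c1 c2.
have h1 := shift a t ht; have h2 := shift (a - t') t' ht'.
have h3 := shift (a + t - t') t' ht'; have h4 := shift 0 t' ht'.
rewrite Rplus_0_l cos_0 in h4.
have E1 : a - t' + t' = a by ring. have E2 : a + t - t' + t' = a + t by ring.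
rewrite E1 in h2; rewrite E2 in h3.
have s1 : - (e / 16) <= (cos t + cos t' - cos (a - t') - cos (a + t)) - (2 - 2 * cos a) <= e / 16 by lra.
have s3 : - (e / 16) <= (2 - 2 * cos (a + t - t')) - (2 - 2 * cos a) <= e / 16 by lra.
have D4 : 0 <= 2 * D <= 4 by lra.
have D4' : 0 <= D * D <= 4 by nra.
have := scale _ _ _ _ D4 s1 => s2.
have := scale _ _ _ _ D4' s3 => s4.
set H := 2 - 2 * cos a + D * D * (2 - 2 * cos a) - 2 * D * (2 - 2 * cos a).
have HE : H = (D - 1) * (D - 1) * (2 - 2 * cos a) by rewrite /H; ring.
have D1 : 0 < (D - 1) * (D - 1) by nra.
have g1 : e3 <= H by rewrite HE /e3; apply: Rmult_le_compat_l; lra.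
have g2 : H <= D * D - e4.
  have -> : D * D - e4 = (D - 1) * (D - 1) * (D * D) by rewrite /e4; ring.
  by rewrite HE w2; apply: Rmult_le_compat_l; lra.
rewrite /H in g1 g2; lra.
Qed.

End Angles.
End PlaneEmbedding.

(** * Diameter graphs from squared distances in the plane *)

Section GoodEvent.
Local Open Scope R_scope.

Lemma le_bigRmax (I : eqType) (r : seq I) (P : pred I) (F : I -> R) i :
  i \in r -> P i -> F i <= \big[Rmax/0]_(j <- r | P j) F j.
Proof.
elim: r => // j r IHr; rewrite inE big_cons => /orP[/eqP<- Pi|ir Pi].
  by rewrite Pi; apply: Rmax_l.
case: (P j); last exact: IHr.
by apply: Rle_trans (IHr ir Pi) _; apply: Rmax_r.
Qed.

Lemma bigRmax_le (I : eqType) (r : seq I) (P : pred I) (F : I -> R) M :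
  0 <= M -> (forall i, P i -> F i <= M) -> \big[Rmax/0]_(j <- r | P j) F j <= M.
Proof. by move=> M0 FM; elim/big_ind: _ => // x y xM yM; apply: Rmax_lub. Qed.

Definition point_of (u : R * R) : point 2 := fun k => if val k is 0%nat then u.1 else u.2.

Lemma euclid_dist_point_of u v : euclid_dist (point_of u) (point_of v) = sqrt (sqdist u v).
Proof. by rewrite /euclid_dist !big_ord_recl big_ord0 /= Rplus_0_r. Qed.

(** The strict lower bound makes the placement injective, and the edge shows that the upper bound
    [D] is attained, so that it is the diameter. *)
Lemma diameter_graph_of_sqdist n (g : graph n) (W : {set 'I_n}) (pos : 'I_n -> R * R) (D : R) :
  0 < D ->
  (forall x y, x \in W -> y \in W -> x <> y ->
    0 < sqdist (pos x) (pos y) <= D * D /\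
    (adj g x y <-> sqdist (pos x) (pos y) = D * D)) ->
  (exists x y, [/\ x \in W, y \in W & adj g x y]) ->
  is_diameter_graph 2 g W.
Proof.
move=> D0 posP [x0 [y0 [x0W y0W a0]]].
have sq0 u : sqdist u u = 0 by rewrite /sqdist !Rminus_diag Rsqr_0; ring.
exists (fun x => point_of (pos x)).
have diamE : diam_img W (fun x => point_of (pos x)) = D.
  apply: Rle_antisym.
    apply: bigRmax_le => [|x xW]; first lra.
    apply: bigRmax_le => [|y yW]; first lra.
    rewrite euclid_dist_point_of -(sqrt_square D); last lra.
    apply: sqrt_le_1_alt; have [->|nxy] := eqVneq x y; first by rewrite sq0; nra.
    by have [[_ ?] _] := posP x y xW yW (elimN eqP nxy).
  have nxy : x0 <> y0 by move=> e; move: a0; rewrite e adj_irr.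
  have [_ [/(_ a0) E _]] := posP x0 y0 x0W y0W nxy.
  rewrite -[X in X <= _](sqrt_square D); last lra.
  rewrite -E -euclid_dist_point_of.
  apply: Rle_trans (le_bigRmax _ (mem_index_enum x0) x0W).
  exact: (le_bigRmax (fun y => euclid_dist (point_of (pos x0)) _) (mem_index_enum y0) y0W).
split=> [x y xW yW fxy|x y xW yW nxy].
  apply/eqP; apply: contraT => /eqP nxy.
  have [[h _] _] := posP x y xW yW nxy.
  have e1 := f_equal (fun f => f ord0) fxy; have e2 := f_equal (fun f => f ord_max) fxy.
  by move: h; rewrite /sqdist; rewrite /point_of /= in e1 e2; rewrite e1 e2 !Rminus_diag Rsqr_0; lra.
have [[h1 h2] [a b]] := posP x y xW yW nxy.
rewrite diamE euclid_dist_point_of; split=> [/a->|E]; first by apply: sqrt_square; lra.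
by apply: b; rewrite -E sqrt_sqrt; lra.
Qed.

End GoodEvent.

(** * The witness: an odd induced cycle with pendant vertices *)

Section CycleWithPendants.
Variables (n : nat) (g : graph n) (c : seq 'I_n) (S : {set 'I_n}).
Hypotheses (c_odd : odd (size c)) (c_gt1 : 1 < size c).
Hypotheses (c_icycle : icycle g c) (S_pendants : pendants g [set x in c] S).
Hypothesis (S_disjoint : [disjoint [set x in c] & S]).

Local Notation L := (size c).
Let W := [set x in c] :|: S.

Lemma adj_nbs U X w y : nbs g w U = X -> y \in U -> adj g w y = (y \in X).
Proof. by move=> <- yU; rewrite inE yU. Qed.

Lemma ipath_adj z v i j : ipath g z -> i < j -> j < size z ->
  adj g (nth v z i) (nth v z j) = (j == i.+1).
Proof.
elim: z i j => [|w z IHz] // [|i] [|j] // pz ij jz; last first.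
  by apply: IHz => //; case/andP: pz.
case: z IHz pz jz => // u z _ pz jz.
have [/andP[_ /eqP E] pz'] := andP pz; have uz := @ipath_uniq _ g (u :: z) pz'.
rewrite [nth v [:: w, u & z] 0]/= [nth v [:: w, u & z] j.+1]/= eqSS.
rewrite (adj_nbs E) ?in_set1 ?in_set ?mem_nth //.
by rewrite -[u in LHS]/(nth v (u :: z) 0) nth_uniq.
Qed.

Lemma icycle_adj v i j : i < j -> j < L ->
  adj g (nth v c i) (nth v c j) = cyclically_adjacent L i j.
Proof.
rewrite /cyclically_adjacent; case: c c_icycle c_odd => [|w [|u z]] //.
move=> /and3P[wz /eqP E pz] oz; case: i j => [|i] [|j] // ij jz; last first.
  by rewrite /= orbF; apply: (ipath_adj (z := u :: z)).
have uz := ipath_uniq pz.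
rewrite [nth v [:: w, u & z] 0]/= [nth v [:: w, u & z] j.+1]/= eqSS.
rewrite (adj_nbs E) ?in_set2 ?in_set ?mem_nth // -[X in _ == X]/(nth v (u :: z) 0).
have -> : last u z = nth v (u :: z) (size z) by rewrite -[last u z]/(last v (u :: z)) -nth_last.
by rewrite !nth_uniq //=.
Qed.

Lemma pendant_nb x : x \in S -> exists2 u, u \in c & forall y, y \in c -> adj g x y = (y == u).
Proof.
have /andP[/forall_inP sP _] := S_pendants => /sP/cards1P[u E].
exists u; last by move=> y yc; rewrite (adj_nbs E) inE.
have : u \in nbs g x [set y in c] by rewrite E set11.
by rewrite !inE => /andP[].
Qed.

Lemma pendants_nonadj x y : x \in S -> y \in S -> adj g x y = false.
Proof.
move=> xS yS; apply/adjP => -[e eg exy]; have /andP[_ /pred0P/(_ e)] := S_pendants.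
rewrite /= eg andbT => /negP; apply.
by rewrite inE; move: exy => /joins_pairP[] -> /=; rewrite xS yS.
Qed.

Lemma pendant_notin x : x \in S -> x \notin c.
Proof. by move=> xS; have := disjointFl S_disjoint xS; rewrite inE => ->. Qed.

Lemma WP x : reflect (x \in c \/ x \in S) (x \in W).
Proof. by rewrite inE [x \in [set _ in _]]inE; apply: orP. Qed.

Lemma card_W : #|W| = L + #|S|.
Proof.
rewrite cardsU disjoint_setI0 // cards0 subn0 cardsE.
by rewrite (card_uniqP (icycle_uniq c_icycle)).
Qed.

Lemma c_sub x : x \in c -> x \in W.
Proof. by move=> xc; apply/WP; left. Qed.

Lemma is_diameter_graph_W : is_diameter_graph 2 g W.
Proof.
have uc := icycle_uniq c_icycle.
have [eta eta0 sep] := pendant_separation c_odd c_gt1.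
have [w1 w2] := width_bounds c_odd c_gt1.
(* The label of a pendant sets its angle, so pendants of the same cycle vertex get distinct
   points. *)
pose ang (x : 'I_n) := (eta * (INR x / INR n))%R.
have angP x : (0 <= ang x <= eta)%R.
  have xn : (INR x < INR n)%R by apply: lt_INR; apply/ltP.
  have x0 := pos_INR x.
  have h : (0 <= INR x / INR n <= 1)%R.
    split; first by apply: Rle_mult_inv_pos; lra.
    by apply: (Rmult_le_reg_r (INR n)); [lra | rewrite /Rdiv Rmult_assoc Rinv_l; lra].
  by rewrite /ang; split; nra.
have ang_inj x y : ang x = ang y -> x = y.
  move=> e; apply/val_inj/INR_eq.
  have xn : (INR x < INR n)%R by apply: lt_INR; apply/ltP.
  have x0 := pos_INR x.
  have := Rmult_eq_reg_l _ _ _ e ltac:(lra) => h.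
  by apply: (Rmult_eq_reg_r (/ INR n)) => //; apply: Rinv_neq_0_compat; lra.
(* For a pendant, [find] returns the position of its only neighbour on the cycle. *)
pose pos (x : 'I_n) := if x \in c then cycle_pt L (index x c)
  else pendant_pt L (width L) (find (adj g x) c) (ang x).
have posc x : x \in c -> pos x = cycle_pt L (index x c) by rewrite /pos => ->.
have posS x u : x \in S -> u \in c -> (forall y, y \in c -> adj g x y = (y == u)) ->
    pos x = pendant_pt L (width L) (index u c) (ang x).
  move=> xS uc' xu; rewrite /pos (negbTE (pendant_notin xS)); congr pendant_pt.
  by apply: eq_in_find => y /xu.
have idx x : x \in c -> index x c < L by rewrite index_mem.
have index_neq x y : x \in c -> x <> y -> index x c <> index y c.
  move=> xc nxy e; apply: nxy.
  by rewrite -(nth_index x xc) e nth_index // -index_mem -e index_mem.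
have cc x y : x \in c -> y \in c -> index x c < index y c ->
    (0 < sqdist (pos x) (pos y) <= width L * width L)%R /\
    (adj g x y <-> sqdist (pos x) (pos y) = (width L * width L)%R).
  move=> xc yc lt; rewrite !posc // sqdist_cycle.
  have := cos_cycle_angle c_odd c_gt1 lt (idx y yc).
  have := kappa_bounds c_odd c_gt1; rewrite (width_sqr c_odd c_gt1).
  have -> : adj g x y = cyclically_adjacent L (index x c) (index y c).
    by rewrite -(icycle_adj x lt (idx y yc)) !nth_index.
  move=> kb [b [h1 h2]]; split; first by lra.
  by split=> [/h1|e]; [lra | apply: h2; lra].
have pc x y : x \in S -> y \in c ->
    (0 < sqdist (pos x) (pos y) <= width L * width L)%R /\
    (adj g x y <-> sqdist (pos x) (pos y) = (width L * width L)%R).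
  move=> xS yc; have [u uc' xu] := pendant_nb xS.
  rewrite (posS x u) // posc // xu //.
  have [s1 [s2 _]] := sep _ _ (idx u uc') (angP x).
  have [->|/eqP nyu] := eqVneq y u; first by rewrite s1; split; [nra | split].
  have [] := s2 _ (idx y yc) (index_neq u y uc' (not_eq_sym nyu)).
  by move=> *; split; [lra | split=> // e; lra].
apply: (@diameter_graph_of_sqdist n g W pos (width L)); first by lra.
  move=> x y /WP[xc|xS] /WP[yc|yS] nxy.
  - have := index_neq x y xc nxy => /eqP; rewrite neq_ltn => /orP[lt|lt].
      exact: cc.
    by rewrite sqdist_sym adj_sym; apply: cc.
  - by rewrite sqdist_sym adj_sym; apply: pc.
  - exact: pc.
  rewrite pendants_nonadj //.
  have [u uc' xu] := pendant_nb xS; have [v vc yv] := pendant_nb yS.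
  rewrite (posS x u) // (posS y v) //.
  have [_ [_ s3]] := sep _ _ (idx u uc') (angP x).
  have [|h1 h2] := s3 _ _ (idx v vc) (angP y).
    by case=> _ /ang_inj.
  by split; [lra | split=> // e; lra].
case: c c_icycle c_gt1 (@c_sub) (@icycle_adj) => [|w [|u z]] // _ _ csub cadj.
exists w, u; split; [apply: csub | apply: csub |]; rewrite ?inE ?eqxx ?orbT //.
by have := cadj w 0 1 isT isT => /= ->.
Qed.

Lemma chromatic_W : chromatic_eq g W 3.
Proof.
have uc := icycle_uniq c_icycle.
have [x0 x0c] : exists x0, x0 \in c by case: c c_gt1 => // a l _; exists a; rewrite mem_head.
have idx x : x \in c -> index x c < L by rewrite index_mem.
have adj_idx i j : i < j -> j < L -> cyclically_adjacent L i j ->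
    adj g (nth x0 c i) (nth x0 c j) by move=> ij jL; rewrite icycle_adj.
have Lm1 : ~~ odd L.-1 by case: (L) c_odd.
split.
  (* Colours 0 and 1 alternate along the list, and the last vertex, adjacent to the first, takes
     colour 2. *)
  pose cc i := if i == L.-1 then 2 else odd i : nat.
  have cc_neq i j : i < j -> j < L -> cyclically_adjacent L i j -> cc i <> cc j.
    move=> ij jL; have iL : (i == L.-1) = false.
      by apply: ltn_eqF; apply: leq_trans ij _; case: (L) jL.
    rewrite /cc iL => /orP[/eqP->|/andP[_ ->]]; last by case: (odd i).
    by case: ifP => _ /=; case: (odd i).
  (* A pendant has a single neighbour to avoid, so 0 or 1 is free. *)
  pose col x := if x \in c then cc (index x c)
    else if cc (find (adj g x) c) == 0 then 1 else 0.
  have col_pc x y : x \in S -> y \in c -> adj g x y -> col x <> col y.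
    move=> xS yc; have [u uc' xu] := pendant_nb xS.
    rewrite xu // => /eqP yu; rewrite /col (negbTE (pendant_notin xS)) yc yu.
    have -> : find (adj g x) c = index u c by apply: eq_in_find => z /xu.
    by case: (cc _).
  exists col; split=> [x _|x y /WP[xc|xS] /WP[yc|yS] xy].
  - by rewrite /col /cc; case: ifP => _; case: ifP => _ //; case: (odd _).
  - rewrite /col xc yc; have nxy : index x c != index y c.
      apply: contraTneq xy => /(f_equal (nth x0 c)).
      by rewrite !nth_index // => ->; rewrite adj_irr.
    move: nxy; rewrite neq_ltn => /orP[lt|lt].
      by apply: cc_neq => //; rewrite ?idx // -(icycle_adj x0) ?nth_index ?idx.
    apply: nesym; apply: cc_neq => //; rewrite ?idx // -(icycle_adj x0) ?nth_index ?idx //.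
    by rewrite adj_sym.
  - by apply: nesym; apply: col_pc => //; rewrite adj_sym.
  - exact: col_pc.
  - by rewrite pendants_nonadj in xy.
move=> k [col [col_lt col_adj]]; rewrite leqNgt; apply/negP => k3.
(* With two colours, their parity alternates along the cycle. As [L.-1] is even, the first and last
   vertices then agree in colour although they are adjacent. *)
have lt2 i : i < L -> col (nth x0 c i) < 2.
  by move=> iL; apply: leq_trans (col_lt _ (c_sub (mem_nth x0 iL))) _.
have flip i j : i < j -> j < L -> cyclically_adjacent L i j ->
    odd (col (nth x0 c j)) = ~~ odd (col (nth x0 c i)).
  move=> ij jL a; have iL := ltn_trans ij jL.
  have := col_adj _ _ (c_sub (mem_nth x0 iL)) (c_sub (mem_nth x0 jL)) (adj_idx i j ij jL a).
  by case: (col _) (lt2 i iL) => [|[|?]] //; case: (col _) (lt2 j jL) => [|[|?]].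
have par i : i < L -> odd (col (nth x0 c i)) = odd (col (nth x0 c 0)) (+) odd i.
  elim: i => [|i IHi] iL; first by rewrite addbF.
  rewrite (flip i) ?IHi ?(ltnW iL) //; last by rewrite /cyclically_adjacent eqxx.
  by rewrite /= addbN.
have lastL : L.-1 < L by case: (L) c_gt1.
have := flip 0 L.-1; rewrite par // (negbTE Lm1) addbF => /(_ _ lastL).
rewrite /cyclically_adjacent !eqxx orbT => h.
by have := h ltac:(by case: (L) c_gt1 => [|[|]]) isT; case: (odd _).
Qed.

Lemma connected_W : induced_connected g W.
Proof.
have [x0 x0c] : exists x0, x0 \in c by case: c c_gt1 => // a l _; exists a; rewrite mem_head.
pose e a b := [&& a \in W, b \in W & adj g a b].
have e_sym : connect_sym e.
  by apply: sym_connect_sym => a b; rewrite /e adj_sym andbCA.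
pose r := nth x0 c 0.
have cyc i : i < L -> connect e r (nth x0 c i).
  elim: i => [|i IHi] iL; first exact: connect0.
  apply: connect_trans (IHi (ltnW iL)) _; apply: connect1.
  rewrite /e !c_sub ?mem_nth ?(ltnW iL) //= icycle_adj //.
  by rewrite /cyclically_adjacent eqxx.
have root x : x \in W -> connect e r x.
  case/WP => [xc|xS]; first by rewrite -(nth_index x0 xc) cyc ?index_mem.
  have [u uc xu] := pendant_nb xS.
  apply: (connect_trans (y := u)); first by rewrite -(nth_index x0 uc) cyc ?index_mem.
  apply: connect1; rewrite /e c_sub //= adj_sym xu // eqxx andbT.
  by apply/WP; right.
move=> x y xW yW; apply: (connect_trans (y := r)); last exact: root.
by rewrite e_sym root.
Qed.

Lemma good_event_W conn : good_event 2 (L + #|S|) conn g.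
Proof.
exists W; split; first exact: card_W.
split; first exact: is_diameter_graph_W.
by split; [exact: chromatic_W | move=> _; exact: connected_W].
Qed.

End CycleWithPendants.

(** * Probability estimates *)

Section Bridge.
Import Order.TTheory GRing.Theory Num.Theory.
Local Open Scope ring_scope.
Local Notation R := Rdefinitions.R.

Lemma Pr_le_gnp_prob n (p : R) (P : graph n -> bool) (A : graph n -> Prop) :
  0 <= p -> p <= 1 -> (forall g, P g -> A g) -> Pr p P <= gnp_prob p A.
Proof.
move=> p0 p1 PA; apply: ler_sum => g _.
have -> : gnp_weight p g = weight p g by rewrite weight_card -!RpowE.
case: (ClassicalDescription.excluded_middle_informative (A g)) => [Ag|nA].
  by case: (P g); rewrite ?mulr1 ?mulr0 ?weight_ge0.
by case: (boolP (P g)) => [/PA|]; rewrite ?mulr0.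
Qed.

(** The induction carries the exact partial sum [/ 10 * (1 - (/ 11) ^ s)]. *)
Lemma geometric_sum_le (t : nat -> R) (s : nat) :
  (forall j : nat, (0 < j <= s)%nat -> t j <= ((/ 11) ^ j)%R) ->
  \sum_(1 <= j < s.+1) t j <= (/ 10)%R.
Proof.
move=> tj; suff : \sum_(1 <= j < s.+1) t j <= (/ 10 * (1 - (/ 11) ^ s))%R.
  move=> h; apply: le_trans h _; apply/RleP.
  by have := pow_le (/ 11)%R s ltac:(lra); lra.
elim: s tj => [|s IHs] tj; first by rewrite big_geq //; apply/RleP; change (0 <= / 10 * (1 - 1))%R; lra.
rewrite big_nat_recr //=; apply: le_trans (lerD (IHs _) (tj s.+1 _)) _.
- by move=> j /andP[j0 js]; apply: tj; rewrite j0 ltnW.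
- by rewrite leqnn.
have e (x : R) : (/ 10 * (1 - x) + / 11 * x <= / 10 * (1 - / 11 * x))%R by lra.
by apply/RleP; apply: e.
Qed.

(** [L] is the number of path vertices; it is even so that the closed cycle is odd. The classes are
    three consecutive blocks of [m] labels, and the stages combine to at least
    [(9 / 10)^2 / (11 / 10)]. *)
Lemma gnp_prob_good_event (n m L s : nat) (p : R) (conn : bool) (q := (INR L.+1 * p * (1 - p) ^ L)%R) :
  (0 < p < 1)%R -> ~~ odd L -> (1 < L)%nat -> (0 < m)%nat -> (3 * m <= n)%nat -> (s <= m)%nat ->
  (INR n ^ L.+1 * (1 - p * (1 - p) ^ L) ^ (m - L) <= / 10)%R ->
  ((1 - p ^ 2 * (1 - p) ^ (L - 2)) ^ m <= / 10)%R ->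
  (forall j : nat, (0 < j <= s)%nat ->
    INR 'C(s, j) * ((INR s / INR m) ^ j * / (q ^ j * (1 - p) ^ 'C(j, 2))) <= (/ 11) ^ j)%R ->
  (1 / 2 < gnp_prob p (@good_event 2 n (L.+1 + s) conn))%R.
Proof.
move=> [/RltP p0 /RltP p1] oL L1 m0 mn sm /RleP b1 /RleP b2 b3.
have lt_slot k (i : 'I_m) : (k < 3)%nat -> (k * m + i < n)%nat.
  move=> k3; apply: leq_trans mn; apply: leq_trans (_ : k.+1 * m <= _)%nat.
    by rewrite mulSn addnC ltn_add2r.
  by rewrite leq_mul2r k3 orbT.
pose part k : {set 'I_n} := [set x : 'I_n | (k * m <= x < k.+1 * m)%nat].
have card_part k : (k < 3)%nat -> #|part k| = m.
  move=> k3; rewrite -[RHS]card_ord -cardsT.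
  rewrite -(card_imset [set: 'I_m] (f := fun i => Ordinal (lt_slot k i k3))); last first.
    by move=> i j [/addnI/ord_inj].
  apply: eq_card => x; rewrite inE; apply/idP/imsetP => [/andP[l u]|[i _ ->]] /=.
    have lt : (x - k * m < m)%nat by rewrite ltn_subLR // addnC -mulSn.
    by exists (Ordinal lt); rewrite ?in_setT //; apply: val_inj; rewrite /= subnKC.
  by rewrite leq_addr /= mulSn addnC ltn_add2r.
have dis k k' : (k < k')%nat -> [disjoint part k & part k'].
  move=> kk'; apply/pred0P=> x /=; rewrite !inE; apply/andP=> -[/andP[_ a] /andP[b _]].
  have : (x < x)%nat.
    by apply: leq_trans a (leq_trans _ b); rewrite leq_mul2r kk' orbT.
  by rewrite ltnn.
have dAD := dis 0%nat 1%nat isT.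
have dADB : [disjoint part 0%nat :|: part 1%nat & part 2%nat].
  by rewrite -setI_eq0 setIUl setU_eq0 !setI_eq0 !dis.
have A0 : part 0%nat != set0 by rewrite -card_gt0 card_part.
have B0 : (0 < #|part 2%nat|)%nat by rewrite card_part.
have sB : (s <= #|part 2%nat|)%nat by rewrite card_part.
have := Pr_icycle_pendants (ltW p0) (ltW p1) p0 p1 dAD dADB L1 A0 B0 sB.
rewrite !card_part // => h.
pose x1 := (INR n ^ L.+1 * (1 - p * (1 - p) ^ L) ^ (m - L))%R.
pose x2 := ((1 - p ^ 2 * (1 - p) ^ (L - 2)) ^ m)%R.
pose t (j : nat) := (INR 'C(s, j) * ((INR s / INR m) ^ j * / (q ^ j * (1 - p) ^ 'C(j, 2))))%R.
pose beta := \sum_(1 <= j < s.+1) t j.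
have {}h : (1 - x1) * (1 - x2) * (1 + beta)^-1 <=
    Pr p (fun g => [exists c : L.+1.-tuple 'I_n,
      (icycle g c && all (mem (part 0%nat :|: part 1%nat)) c) &&
      [exists S : {set 'I_n}, (S \subset part 2%nat) && (#|S| == s) && pendants g [set x in c] S]]).
  apply: le_trans h; rewrite le_eqVlt; apply/orP; left; apply/eqP.
  rewrite /x1 /x2 !RpowE INRE -natrX; congr (_ * (_ + _)^-1).
  by apply: eq_bigr => j _; rewrite /t /q !RpowE !INRE.
have beta_ge0 : 0 <= beta.
  apply: sumr_ge0 => j _; apply/RleP.
  have q0 : (0 < q)%R.
    move/RltP: p0 => p0; move/RltP: p1 => p1; apply: Rmult_lt_0_compat; last by apply: pow_lt; lra.
    by apply: Rmult_lt_0_compat => //; apply: lt_0_INR; lia.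
  apply: Rmult_le_pos; first exact: pos_INR.
  apply: Rmult_le_pos.
    apply: pow_le; apply: Rle_mult_inv_pos; first exact: pos_INR.
    by apply: lt_0_INR; apply/ssrnat.ltP.
  apply: Rlt_le; apply: Rinv_0_lt_compat; apply: Rmult_lt_0_compat; apply: pow_lt => //.
  by move/RltP: p1 => p1; lra.
have /RleP beta_le : beta <= (/ 10)%R.
  by apply: geometric_sum_le => j js; apply/RleP; apply: b3.
move/RleP: b1 => b1; move/RleP: b2 => b2; move/RleP: beta_ge0 => beta_ge0.
have num : (1 / 2 < (1 - x1) * (1 - x2) * / (1 + beta))%R.
  have y1 : (9 / 10 <= 1 - x1)%R by rewrite /x1; lra.
  have y2 : (9 / 10 <= 1 - x2)%R by rewrite /x2; lra.
  have y3 : (/ (11 / 10) <= / (1 + beta))%R.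
    by apply: Rinv_le_contravar; [change (0 <= beta)%R in beta_ge0|]; lra.
  have y12 : (81 / 100 <= (1 - x1) * (1 - x2))%R by nra.
  have : (81 / 100 * / (11 / 10) <= (1 - x1) * (1 - x2) * / (1 + beta))%R.
    by apply: Rmult_le_compat; lra.
  lra.
apply: Rlt_le_trans num _; apply/RleP; apply: (le_trans h).
apply: Pr_le_gnp_prob; [exact: ltW | exact: ltW | ].
move=> g /existsP[c /andP[/andP[ic /allP cA] /existsP[S /andP[/andP[sSB /eqP cS] pS]]]].
have := @good_event_W n g c S _ _ ic pS _ conn; rewrite size_tuple cS; apply; rewrite ?ltnS ?(ltnW L1) //.
apply: disjointWl (disjointWr sSB dADB).
by apply/subsetP=> x; rewrite inE => /cA.
Qed.
End Bridge.

(** * Elementary inequalities *)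

Section Estimates.
Local Open Scope R_scope.

Lemma exp_pow a k : exp a ^ k = exp (INR k * a).
Proof.
elim: k => [|k IHk]; first by rewrite /= Rmult_0_l exp_0.
by rewrite S_INR /= IHk -exp_plus; congr exp; ring.
Qed.

Lemma exp_monotone a b : a <= b -> exp a <= exp b.
Proof. by case=> [ab|->]; [left; apply: exp_increasing | right]. Qed.

Lemma one_minus_le_exp y : 1 - y <= exp (- y).
Proof. by have := exp_ineq1_le (- y); lra. Qed.

Lemma pow_one_minus_le y k : 0 <= y <= 1 -> (1 - y) ^ k <= exp (- (y * INR k)).
Proof.
move=> y01; have -> : - (y * INR k) = INR k * - y by ring.
rewrite -exp_pow; apply: pow_incr; have := one_minus_le_exp y; lra.
Qed.

Lemma bernoulli y k : 0 <= y <= 1 -> 1 - INR k * y <= (1 - y) ^ k.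
Proof.
move=> y01; elim: k => [|k IHk]; first by rewrite /=; lra.
rewrite S_INR /=; have k0 := pos_INR k.
have : (1 - y) * (1 - INR k * y) <= (1 - y) * (1 - y) ^ k by apply: Rmult_le_compat_l; lra.
have : 0 <= INR k * (y * y) by apply: Rmult_le_pos => //; nra.
nra.
Qed.

(** The left side equals [1 + y + y * y / (1 - y)], and [1 - y] is at least 1/2. *)
Lemma inv_one_minus_le y : 0 <= y <= 1 / 2 -> / (1 - y) <= exp (y + 2 * y * y).
Proof.
move=> y01; apply: Rle_trans (exp_monotone (_ : y + y * y * / (1 - y) <= _)); last first.
  have : / (1 - y) <= 2.
    have -> : 2 = / (1 / 2) by field.
    by apply: Rinv_le_contravar; lra.
  have : 0 <= y * y by nra.
  nra.
apply: Rle_trans (exp_ineq1_le _).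
by right; field; lra.
Qed.

(** A weak Stirling bound: in the induction the factor [(1 + / INR j) ^ j] is at most e, hence at
    most 3. *)
Lemma fact_lower j : INR j ^ j <= 3 ^ j * INR j`!.
Proof.
elim: j => [|j IHj]; first by rewrite /=; lra.
have [->|j0] := posnP j; first by rewrite (_ : 1`! = 1%nat) //=; lra.
have jp : 0 < INR j by apply: lt_0_INR; apply/ssrnat.ltP.
rewrite factS mult_INR.
have E : INR j.+1 ^ j = INR j ^ j * (1 + / INR j) ^ j.
  by rewrite -Rpow_mult_distr; congr (_ ^ _); rewrite S_INR; field; lra.
have h : (1 + / INR j) ^ j <= 3.
  apply: Rle_trans exp_le_3.
  have -> : 1 = INR j * / INR j by field; lra.
  rewrite -exp_pow; apply: pow_incr; split; last first.
    by have := exp_ineq1_le (/ INR j); rewrite Rinv_r; lra.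
  by have := Rinv_0_lt_compat _ jp; rewrite Rinv_r; lra.
have a1 : 0 <= INR j.+1 by apply: pos_INR.
have a2 : 0 <= INR j ^ j by apply: pow_le; lra.
have a3 : 0 <= (1 + / INR j) ^ j.
  by apply: pow_le; have := Rinv_0_lt_compat _ jp; lra.
rewrite -[INR j.+1 ^ j.+1]/(INR j.+1 * INR j.+1 ^ j) E -[3 ^ j.+1]/(3 * 3 ^ j).
have : INR j ^ j * (1 + / INR j) ^ j <= (3 ^ j * INR j`!) * 3 by apply: Rmult_le_compat.
move=> h2; have := Rmult_le_compat_l _ _ _ a1 h2; lra.
Qed.

Lemma bin_upper s j : (0 < j)%nat -> INR 'C(s, j) <= (3 * INR s / INR j) ^ j.
Proof.
move=> j0; have jp : 0 < INR j by apply: lt_0_INR; apply/ssrnat.ltP.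
have fp : 0 < INR j`! by apply: lt_0_INR; apply/ssrnat.ltP; apply: fact_gt0.
have ffle : INR 'C(s, j) * INR j`! <= INR s ^ j.
  rewrite -mult_INR -pow_INR; apply: le_INR; apply/ssrnat.leP; rewrite multE bin_ffact.
  have -> : (PeanoNat.Nat.pow s j = expn s j).
    by elim: j {j0 jp fp} => // j IHj; rewrite expnS /= IHj.
  rewrite ffact_prod -[X in expn _ X]card_ord -prod_nat_const.
  by apply: leq_prod => i _; apply: leq_subr.
have -> : (3 * INR s / INR j) ^ j = 3 ^ j * INR s ^ j * / INR j ^ j.
  by rewrite -pow_inv -!Rpow_mult_distr.
apply: (Rmult_le_reg_r (INR j ^ j)); first exact: pow_lt.
rewrite Rmult_assoc Rinv_l; last by apply: pow_nonzero; lra.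
rewrite Rmult_1_r.
apply: Rle_trans (_ : INR 'C(s, j) * (3 ^ j * INR j`!) <= _).
  by apply: Rmult_le_compat_l; [apply: pos_INR | apply: fact_lower].
have t3 : 0 <= 3 ^ j by apply: pow_le; lra.
have := Rmult_le_compat_l _ _ _ t3 ffle; lra.
Qed.

Lemma exp_dominates_square c K : 0 < c -> 0 < K ->
  exists X, forall x, X <= x -> 1 <= x /\ K * (x * x) <= exp (c * x).
Proof.
(* Beyond [X] the product [c * c * x] is at least [16 * (1 + K)], so the fourth power of
   [c * x / 4], a lower bound for the exponential, has the factor [(1 + K)^2 >= K] in front of
   [x * x]. *)
move=> c0 K0; pose X := 1 + 16 * (1 + K) / (c * c).
have c2 : 0 < c * c by apply: Rmult_lt_0_compat.
have X0 : 0 < 16 * (1 + K) / (c * c) by apply: Rdiv_lt_0_compat; lra.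
exists X => x Xx; split; first by rewrite /X in Xx; lra.
have x0 : 0 < x by rewrite /X in Xx; lra.
have y0 : 0 < c * x / 4 by apply: Rdiv_lt_0_compat; [apply: Rmult_lt_0_compat | lra].
have h1 : c * x / 4 <= exp (c * x / 4) by have := exp_ineq1_le (c * x / 4); lra.
have -> : exp (c * x) = exp (c * x / 4) ^ 4.
  by rewrite exp_pow; congr exp; rewrite /=; field.
apply: Rle_trans (pow_incr _ _ 4 (conj (Rlt_le _ _ y0) h1)).
have hx : 16 * (1 + K) <= c * c * x.
  have -> : 16 * (1 + K) = c * c * (16 * (1 + K) / (c * c)) by field; lra.
  by apply: Rmult_le_compat_l; rewrite /X in Xx; lra.
have hx2 : 16 * (1 + K) * (16 * (1 + K)) <= (c * c * x) * (c * c * x).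
  by apply: Rmult_le_compat; lra.
have hx3 : K <= (c * c * x) * (c * c * x) / 256 by nra.
have -> : (c * x / 4) ^ 4 = (c * c * x) * (c * c * x) / 256 * (x * x) by field.
by apply: Rmult_le_compat_r => //; nra.
Qed.

Lemma exists_ceil y : 0 <= y -> exists k : nat, y <= INR k <= y + 1.
Proof.
move=> y0; have [a b] := archimed y.
have z0 : (0 <= up y)%Z by apply: le_IZR; lra.
have [k E] := IZN _ z0; exists k; rewrite INR_IZR_INZ -E; lra.
Qed.

(** * Numerical estimates for the chosen parameters *)

Section Regime.
Variables (alpha C eps delta x p : R) (n h m s : nat).
(** Here [x] is ln n, so [ex a] is n^a and [T] below is n^delta. The factors of [K] let the single
    hypothesis [big] absorb numerical constants, [C] and [/ delta] alike. *)
Let K := 100000 * (1 + C) * (1 + / delta).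
Let kappa := 2 - 2 * alpha - eps.
Let ex (a : R) := exp (a * x).
Hypotheses (alpha0 : 0 < alpha < 1 / 2) (C0 : 0 < C) (delta0 : 0 < delta)
  (da : 4 * delta <= alpha) (da2 : 4 * delta <= 1 - 2 * alpha) (de : 4 * delta <= eps)
  (kappa0 : 0 < kappa) (x1 : 1 <= x) (nE : INR n = exp x)
  (p_lo : exp (- alpha * x) < p) (p_hi : p < C * exp (- alpha * x))
  (big : K * (x * x) <= exp (delta * x)).
Hypotheses (h_lo : ex (alpha - delta) <= INR h) (h_hi : INR h <= ex (alpha - delta) + 1)
  (m_lo : INR n / 4 <= INR m) (m_hi : (3 * m <= n)%nat)
  (s_lo : kappa * x / p <= INR s) (s_hi : INR s <= kappa * x / p + 1).

Let ex_gt0 a : 0 < ex a. Proof. exact: exp_pos. Qed.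
Let exD a b : ex (a + b) = ex a * ex b.
Proof. by rewrite /ex -exp_plus; congr exp; ring. Qed.
Let ex_le a b : a <= b -> ex a <= ex b.
Proof. by move=> ab; apply: exp_monotone; apply: Rmult_le_compat_r; lra. Qed.
Let T := ex delta.

Let T_big : 100000 * (x * x) <= T /\ 100000 * C * (x * x) <= T /\ 100000 * / delta * (x * x) <= T.
Proof.
have d0 : 0 < / delta by apply: Rinv_0_lt_compat.
have xx : 0 <= x * x by nra.
have Cd : 0 < C * / delta by apply: Rmult_lt_0_compat.
have : K = 100000 + 100000 * C + 100000 * / delta + 100000 * (C * / delta) by rewrite /K; ring.
move: big; rewrite -/(ex delta) -/T => b E; rewrite E in b.
have a1 : 0 <= C * (x * x) by apply: Rmult_le_pos; lra.
have a2 : 0 <= / delta * (x * x) by apply: Rmult_le_pos; lra.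
have a3 : 0 <= (C * / delta) * (x * x) by apply: Rmult_le_pos; lra.
repeat split; lra.
Qed.

Let p0 : 0 < p. Proof. by have := exp_pos (- alpha * x); lra. Qed.

Let pC : p * T <= C.
Proof.
have e0 : ex (- alpha) * T <= 1.
  by rewrite -exD -exp_0; apply: exp_monotone; nra.
have T0 : 0 < T by apply: ex_gt0.
have h1 : p * T <= C * ex (- alpha) * T by apply: Rmult_le_compat_r; apply: Rlt_le.
by have := Rmult_le_compat_l C _ _ (Rlt_le _ _ C0) e0; lra.
Qed.

Let p_small : p * (x * x) <= / 100000.
Proof.
have [_ [b _]] := T_big; have := p0 => p0'.
have xx : 0 < x * x by nra.
have h1 : p * (100000 * C * (x * x)) <= C.
  by apply: Rle_trans pC; apply: Rmult_le_compat_l; lra.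
have : C * (p * (x * x)) <= C * / 100000 by lra.
by move/Rmult_le_reg_l; apply.
Qed.

Let p_lt : p <= / 100000.
Proof.
have xx : 1 <= x * x by nra.
by have := Rmult_le_compat_l p _ _ (Rlt_le _ _ p0) xx; have := p_small; lra.
Qed.

Let p_ex : ex (- alpha) <= p. Proof. exact: Rlt_le. Qed.

Let invp : / p <= ex alpha.
Proof.
have -> : ex alpha = / ex (- alpha).
  by rewrite /ex -exp_Ropp; congr exp; ring.
by apply: Rinv_le_contravar => //; apply: ex_gt0.
Qed.

Let ex_ge1 a : 0 <= a -> 1 <= ex a.
Proof. by move=> a0; rewrite -exp_0; apply: exp_monotone; apply: Rmult_le_pos; lra. Qed.

Let T_le a : delta <= a -> T <= ex a. Proof. exact: ex_le. Qed.

Let sp : INR s * p <= 2 * x + p.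
Proof.
have := p0 => p0'.
have : INR s * p <= (kappa * x / p + 1) * p by apply: Rmult_le_compat_r; lra.
have -> : (kappa * x / p + 1) * p = kappa * x + p by field; lra.
have : kappa * x <= 2 * x by apply: Rmult_le_compat_r; rewrite /kappa; lra.
lra.
Qed.

Let s_ub : INR s <= 3 * x * ex alpha.
Proof.
have a1 := ex_ge1 (a := alpha) ltac:(lra).
have : kappa * x / p <= 2 * x * ex alpha.
  apply: Rmult_le_compat => //; first by apply: Rmult_le_pos; lra.
    by apply: Rlt_le; apply: Rinv_0_lt_compat.
  by apply: Rmult_le_compat_r; rewrite /kappa; lra.
have : 1 <= x * ex alpha by nra.
lra.
Qed.

Let l_ub : INR (2 * h) <= 2 * ex (alpha - delta) + 2.
Proof. by rewrite mult_INR /=; lra. Qed.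

(** Shortening the cycle by n^delta against 1 / p outweighs [C]. By Bernoulli's inequality, avoiding
    a whole path then costs at most a factor 1/2. *)
Let lp : (INR (2 * h) + 1) * p <= 1 / 2.
Proof.
have [b1 [b2 _]] := T_big; have := p0 => p0'.
have E : ex (alpha - delta) * T = ex alpha by rewrite -exD; congr ex; ring.
have q1 : ex (alpha - delta) * p <= / 100000.
  have T0 : 0 < T by apply: ex_gt0.
  apply: (Rmult_le_reg_r T) => //.
  have -> : ex (alpha - delta) * p * T = ex alpha * p by rewrite -E; ring.
  have : ex alpha * p <= ex alpha * (C * ex (- alpha)).
    by apply: Rmult_le_compat_l; [apply: Rlt_le | apply: Rlt_le].
  have -> : ex alpha * (C * ex (- alpha)) = C * (ex alpha * ex (- alpha)) by ring.
  rewrite -exD Rplus_opp_r /ex Rmult_0_l exp_0.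
  have xx : 1 <= x * x by nra.
  have := Rmult_le_compat_l C _ _ (Rlt_le _ _ C0) xx; lra.
have h1 : (INR (2 * h) + 1) * p <= (2 * ex (alpha - delta) + 3) * p.
  by apply: Rmult_le_compat_r; [lra | have := l_ub; lra].
have := p_lt; lra.
Qed.

Let T_lin : 10000 * x <= T.
Proof. by have [b _] := T_big; have : x <= x * x by [nra]; lra. Qed.

Let s_le_m : (s <= m)%nat.
Proof.
apply/ssrnat.leP/INR_le; apply: Rle_trans s_ub _; apply: Rle_trans m_lo.
have [b1 _] := T_big.
have -> : INR n = ex alpha * ex (1 - alpha) by rewrite nE -exD /ex; congr exp; ring.
have Ta : T <= ex (1 - alpha) by apply: T_le; lra.
have := Rmult_le_compat_l _ _ _ (Rlt_le _ _ (ex_gt0 alpha)) (Rle_trans _ _ _ T_lin Ta).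
have : 0 <= ex alpha * x by apply: Rmult_le_pos; [apply: Rlt_le | lra].
lra.
Qed.

Let m_gt0 : (0 < m)%nat.
Proof. by apply/ssrnat.ltP/INR_lt; apply: Rlt_le_trans m_lo; rewrite nE; have := exp_pos x; rewrite /=; lra. Qed.

Let p01 : 0 < p < 1. Proof. by have := p0; have := p_lt; lra. Qed.

Let half_pow : 1 / 2 <= (1 - p) ^ (2 * h).
Proof.
apply: Rle_trans (bernoulli (2 * h) _); last by have := p01; lra.
by have := lp; have := p0; lra.
Qed.

Let exp9 : exp (- 9) <= / 10.
Proof.
have e9 := exp_ineq1_le 9.
apply: (Rmult_le_reg_r (exp 9)); first lra.
have -> : exp (- 9) * exp 9 = 1 by rewrite -exp_plus -exp_0; congr exp; ring.
lra.
Qed.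

(** In the exponent, the union bound costs order n^alpha ln n and the failure probability gains
    order p n >= n^(1 - alpha); their quotient is at least [T] up to the logarithm. *)
Lemma path_estimate :
  INR n ^ (2 * h).+1 * (1 - p * (1 - p) ^ (2 * h)) ^ (m - 2 * h) <= / 10.
Proof.
have [b1 _] := T_big; have hp := half_pow; have := p01 => -[pp0 pp1].
have ea := ex_gt0 alpha.
have Tb : T <= ex (1 - 2 * alpha) by apply: T_le; lra.
have nE' : INR n = ex alpha * ex alpha * ex (1 - 2 * alpha).
  by rewrite nE -!exD /ex; congr exp; ring.
have ea1 := ex_ge1 (a := alpha) ltac:(lra).
have lub : INR (2 * h) <= 4 * ex alpha.
  have := ex_le (a := alpha - delta) (b := alpha) ltac:(lra); have := l_ub; lra.
have l8 : INR (2 * h) <= INR n / 8.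
  have t1 : 32 <= ex alpha * ex (1 - 2 * alpha) by nra.
  by have := Rmult_le_compat_l _ _ _ (Rlt_le _ _ ea) t1; rewrite nE'; lra.
have n0 := pos_INR n.
have lm : (2 * h <= m)%nat by apply/ssrnat.leP/INR_le; lra.
have mlE : INR n / 8 <= INR (m - 2 * h).
  by rewrite minus_INR; [lra | apply/ssrnat.leP].
have th : 0 <= 1 - p * (1 - p) ^ (2 * h) <= 1 - p / 2.
  have : (1 - p) ^ (2 * h) <= 1.
    by rewrite -[X in _ <= X](pow1 (2 * h)); apply: pow_incr; lra.
  by split; nra.
apply: Rle_trans exp9; rewrite nE exp_pow.
apply: Rle_trans (_ : exp (INR (2 * h).+1 * x) * exp (- (p / 2 * INR (m - 2 * h))) <= _).
  apply: Rmult_le_compat_l; first exact: Rlt_le (exp_pos _).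
  apply: Rle_trans (pow_one_minus_le _ _); last lra.
  exact: pow_incr.
rewrite -exp_plus; apply: exp_monotone; rewrite S_INR.
have pn : ex alpha * ex (1 - 2 * alpha) <= p * INR n.
  have -> : ex alpha * ex (1 - 2 * alpha) = ex (- alpha) * INR n.
    by rewrite nE -exD -[exp x](_ : ex 1 = _) -?exD /ex; [congr exp; ring | rewrite Rmult_1_l].
  by apply: Rmult_le_compat_r => //; apply: pos_INR.
have r1 : p * INR n / 16 <= p / 2 * INR (m - 2 * h) by nra.
have r2 : (INR (2 * h) + 1) * x + 9 <= 14 * x * ex alpha.
  have : (INR (2 * h) + 1) * x <= (5 * ex alpha) * x by apply: Rmult_le_compat_r; lra.
  have : 1 <= ex alpha * x by nra.
  lra.
have r4 : 0 <= ex alpha * x by apply: Rmult_le_pos; lra.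
have r3 := Rmult_le_compat_l _ _ _ (Rlt_le _ _ ea) (Rle_trans _ _ _ T_lin Tb).
lra.
Qed.

Lemma closing_estimate : (1 - p ^ 2 * (1 - p) ^ (2 * h - 2)) ^ m <= / 10.
Proof.
have [b1 _] := T_big; have hp := half_pow; have := p01 => -[pp0 pp1].
have Tb : T <= ex (1 - 2 * alpha) by apply: T_le; lra.
have hp2 : (1 - p) ^ (2 * h) <= (1 - p) ^ (2 * h - 2).
  have [lt|ge] := ltnP (2 * h) 2.
    have -> : (2 * h - 2 = 0)%nat by apply/eqP; rewrite subn_eq0 ltnW.
    by rewrite -[X in _ <= X](pow1 (2 * h)); apply: pow_incr; lra.
  rewrite -[in X in X <= _](subnK ge) pow_add.
  have : 0 <= (1 - p) ^ (2 * h - 2) by apply: pow_le; lra.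
  have : (1 - p) ^ 2 <= 1 by rewrite /=; nra.
  nra.
have up : (1 - p) ^ (2 * h - 2) <= 1.
  by rewrite -[X in _ <= X](pow1 (2 * h - 2)); apply: pow_incr; lra.
have p2 : 0 <= p ^ 2 <= 1 by rewrite /=; nra.
apply: Rle_trans exp9.
apply: Rle_trans (_ : (1 - p ^ 2 / 2) ^ m <= _).
  by apply: pow_incr; split; nra.
apply: Rle_trans (pow_one_minus_le _ _) _; first lra.
apply: exp_monotone.
have pn : ex (1 - 2 * alpha) <= p ^ 2 * INR n.
  have -> : ex (1 - 2 * alpha) = ex (- alpha) ^ 2 * INR n.
    rewrite nE -[exp x](_ : ex 1 = _); last by rewrite /ex Rmult_1_l.
    by rewrite /= Rmult_1_r -!exD; congr ex; ring.
  apply: Rmult_le_compat_r; first exact: pos_INR.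
  by apply: pow_incr; split=> //; apply: Rlt_le.
nra.
Qed.

(** This is the j-th root of the overlap bound: 33 is 3 from the binomial times the ratio 11, [T]
    bounds [/ q], and the exponential bounds the missing slots per vertex. *)
Let base_estimate j : (0 < j <= s)%nat ->
  33 * INR s * INR s * T * exp ((p + 2 * p * p) * (INR j / 2)) <= INR j * INR m.
Proof.
case/andP=> /ssrnat.leP/le_INR j1 /ssrnat.leP/le_INR js; rewrite [INR 1]/= in j1.
have [b1 [_ b3]] := T_big; have := p01 => -[pp0 pp1].
have T0 : 0 < T by apply: ex_gt0.
have s0 := pos_INR s; have s2 : 0 <= INR s * INR s by nra.
pose F := exp (p * INR j / 2).
have F0 : 0 < F by apply: exp_pos.
(* As [p * p * j] is at most 1, the second-order term costs a factor e, at most 3. *)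
have EF : exp ((p + 2 * p * p) * (INR j / 2)) <= 3 * F.
  apply: Rle_trans (_ : exp 1 * F <= _); last first.
    by apply: Rmult_le_compat_r; [lra | apply: exp_le_3].
  rewrite -exp_plus; apply: exp_monotone.
  have h1 : p * (INR j * p) <= p * (2 * x + p).
    by apply: Rmult_le_compat_l; [lra | apply: Rle_trans sp; apply: Rmult_le_compat_r; lra].
  have xx : x <= x * x by nra.
  have h2 := Rmult_le_compat_l _ _ _ (Rlt_le _ _ pp0) xx.
  have h3 := p_small; nra.
(* 396 is 33 times 3 from [EF] times 4 from [m_lo]. *)
suff : 396 * (INR s * INR s) * T * F <= INR j * INR n.
  move=> h1; have h2 : INR j * (INR n / 4) <= INR j * INR m by apply: Rmult_le_compat_l; lra.
  have h3 : INR s * INR s * T * exp ((p + 2 * p * p) * (INR j / 2)) <= INR s * INR s * T * (3 * F).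
    by apply: Rmult_le_compat_l => //; apply: Rmult_le_pos; lra.
  lra.
have n1 : INR n = ex 1 by rewrite nE /ex Rmult_1_l.
have xT : x <= x * x by nra.
(* For small [j] the exponential is at most n^delta and s^2, of order n^(2 alpha) up to logarithms,
   is beaten by n. For large [j] the exponential matters, but [j] itself contributes a factor of
   order ln n / p. *)
have [small|large] := Rle_or_lt (p * INR j / 2) (delta * x).
  have FT : F <= T by apply: exp_monotone.
  have ss : INR s * INR s <= 9 * (x * x) * ex (2 * alpha).
    have -> : 9 * (x * x) * ex (2 * alpha) = (3 * x * ex alpha) * (3 * x * ex alpha).
      have -> : 2 * alpha = alpha + alpha by ring.
      by rewrite exD; ring.
    by apply: Rmult_le_compat.
  have T3 : T * T * T <= ex (1 - 2 * alpha) by rewrite -!exD; apply: ex_le; lra.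
  apply: Rle_trans (_ : 396 * (9 * (x * x) * ex (2 * alpha)) * T * T <= _).
    apply: Rmult_le_compat => //; try lra.
      by apply: Rmult_le_pos; lra.
    by apply: Rmult_le_compat_r; lra.
  apply: Rle_trans (_ : ex (2 * alpha) * (T * T * T) <= _).
    have -> : 396 * (9 * (x * x) * ex (2 * alpha)) * T * T = (3564 * (x * x)) * (ex (2 * alpha) * (T * T)) by ring.
    have -> : ex (2 * alpha) * (T * T * T) = T * (ex (2 * alpha) * (T * T)) by ring.
    apply: Rmult_le_compat_r; last by nra.
    by apply: Rmult_le_pos; [apply: Rlt_le | nra].
  have -> : INR n = ex (2 * alpha) * ex (1 - 2 * alpha) by rewrite n1 -exD; congr ex; ring.
  rewrite -[X in X <= _]Rmult_1_l; apply: Rmult_le_compat => //; try lra.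
    by apply: Rmult_le_pos; [apply: Rlt_le | nra].
  by apply: Rmult_le_compat_l => //; apply: Rlt_le.
have ps : p * INR s <= kappa * x + p.
  have : p * INR s <= p * (kappa * x / p + 1) by apply: Rmult_le_compat_l; lra.
  have -> : p * (kappa * x / p + 1) = kappa * x + p by field; lra.
  by [].
(* Here the constant is decided: [p * s / 2] is about [kappa * x / 2], so [F] is at most of order
   n^(1 - alpha - eps / 2). Together with s^2 p, of order n^alpha up to logarithms, this leaves
   n^(eps / 2) to spare. *)
pose G := ex (1 - alpha - eps / 2).
have G0 : 0 < G by apply: ex_gt0.
have FG : F <= 3 * G.
  apply: Rle_trans (_ : exp 1 * G <= _); last first.
    by apply: Rmult_le_compat_r; [lra | apply: exp_le_3].
  rewrite -exp_plus; apply: exp_monotone.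
  have : p * INR j <= p * INR s by apply: Rmult_le_compat_l; lra.
  have : kappa * x = 2 * ((1 - alpha - eps / 2) * x) by rewrite /kappa; field.
  lra.
have ssp : INR s * INR s * p <= 9 * (x * x) * ex alpha.
  have -> : 9 * (x * x) * ex alpha = (3 * x * ex alpha) * (3 * x) by ring.
  have -> : INR s * INR s * p = INR s * (INR s * p) by ring.
  by apply: Rmult_le_compat => //; [apply: Rmult_le_pos; lra | have := sp; lra].
have T2 : T * T <= ex (eps / 2) by rewrite -exD; apply: ex_le; lra.
have Td : 100000 * (x * x) <= delta * T.
  have := Rmult_le_compat_l _ _ _ (Rlt_le _ _ delta0) b3.
  have -> : delta * (100000 * / delta * (x * x)) = 100000 * (x * x) by field; lra.
  by [].
have key : 396 * (INR s * INR s * p) * T * F <= 2 * (delta * x) * INR n.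
  apply: Rle_trans (_ : 396 * (9 * (x * x) * ex alpha) * T * (3 * G) <= _).
    apply: Rmult_le_compat => //; try lra.
      by apply: Rmult_le_pos; [apply: Rmult_le_pos; [lra | apply: Rmult_le_pos; lra] | lra].
    by apply: Rmult_le_compat_r; lra.
  have nG : INR n = ex alpha * G * ex (eps / 2).
    by rewrite n1 /G -!exD; congr ex; field.
  have a0 : 0 < ex alpha * G by apply: Rmult_lt_0_compat; [apply: ex_gt0 | ].
  have -> : 396 * (9 * (x * x) * ex alpha) * T * (3 * G) = (ex alpha * G) * (10692 * (x * x) * T) by ring.
  have -> : 2 * (delta * x) * INR n = (ex alpha * G) * (2 * (delta * x) * ex (eps / 2)) by rewrite nG; ring.
  apply: Rmult_le_compat_l; first lra.
  have dx : 0 <= 2 * (delta * x) by apply: Rmult_le_pos; nra.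
  apply: Rle_trans (Rmult_le_compat_l _ _ _ dx T2).
  have -> : 2 * (delta * x) * (T * T) = (2 * x * (delta * T)) * T by ring.
  apply: Rmult_le_compat_r; first lra.
  have : 2 * x * (100000 * (x * x)) <= 2 * x * (delta * T) by apply: Rmult_le_compat_l; lra.
  have : x * x <= x * (x * x) by apply: Rmult_le_compat_l; lra.
  nra.
apply: (Rmult_le_reg_r p) => //.
apply: Rle_trans (_ : 2 * (delta * x) * INR n <= _); first by lra.
have : 2 * (delta * x) * INR n <= (p * INR j) * INR n.
  by apply: Rmult_le_compat_r; [apply: pos_INR | lra].
lra.
Qed.

Lemma pendant_estimate j (q := INR (2 * h).+1 * p * (1 - p) ^ (2 * h)) : (0 < j <= s)%nat ->
  INR 'C(s, j) * ((INR s / INR m) ^ j * / (q ^ j * (1 - p) ^ 'C(j, 2))) <= (/ 11) ^ j.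
Proof.
move=> js; have base := base_estimate js; case/andP: js => j0 js.
have := p01 => -[pp0 pp1]; have T0 : 0 < T by apply: ex_gt0.
have m0 : 0 < INR m by apply: lt_0_INR; apply/ssrnat.ltP.
have jp : 0 < INR j by apply: lt_0_INR; apply/ssrnat.ltP.
have s0 := pos_INR s.
(* The cycle has more than [2 * ex (alpha - delta)] vertices; the 2 pays for the factor 1/2 lost in
   [half_pow]. *)
have q_lo : / T <= q.
  have -> : / T = ex (alpha - delta) * ex (- alpha).
    by rewrite /T /ex -exp_Ropp -exp_plus; congr exp; ring.
  have h1 : 2 * (ex (alpha - delta) * ex (- alpha)) <= INR (2 * h).+1 * p.
    rewrite -Rmult_assoc; apply: Rmult_le_compat => //; try exact: Rlt_le.
      by have := ex_gt0 (alpha - delta); lra.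
    by rewrite S_INR mult_INR /=; lra.
  have h2 : 0 <= INR (2 * h).+1 * p by apply: Rmult_le_pos; [apply: pos_INR | lra].
  have := Rmult_le_compat_l _ _ _ h2 half_pow; rewrite -/q; lra.
have q0 : 0 < q by have := Rinv_0_lt_compat _ T0; lra.
have qT : / q <= T by rewrite -[T]Rinv_inv; apply: Rinv_le_contravar => //; apply: Rinv_0_lt_compat.
pose E := exp ((p + 2 * p * p) * (INR j / 2)).
have E0 : 0 < E by apply: exp_pos.
have binE : (/ (1 - p)) ^ 'C(j, 2) <= E ^ j.
  apply: Rle_trans (pow_incr _ _ _ (conj _ (inv_one_minus_le _))) _.
  - by apply: Rlt_le; apply: Rinv_0_lt_compat; lra.
  - by have := p_lt; lra.
  rewrite !exp_pow; apply: exp_monotone.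
  have pp : 0 <= p + 2 * p * p by nra.
  have b2 : 2 * INR 'C(j, 2) <= INR j * INR j.
    rewrite -[2]/(INR 2) -!mult_INR; apply: le_INR; apply/ssrnat.leP.
    rewrite !multE bin2 mul2n.
    apply: leq_trans (_ : (j * j.-1 <= _)%nat); last by rewrite leq_mul2l leq_pred orbT.
    by rewrite -[X in (_ <= X)%nat]odd_double_half leq_addl.
  have := Rmult_le_compat_l _ _ _ pp b2; lra.
have -> : / (q ^ j * (1 - p) ^ 'C(j, 2)) = (/ q) ^ j * (/ (1 - p)) ^ 'C(j, 2).
  by rewrite Rinv_mult !pow_inv.
have sm0 : 0 <= INR s / INR m by apply: Rle_mult_inv_pos.
have iq0 : 0 <= / q by apply: Rlt_le; apply: Rinv_0_lt_compat.
have ip0 : 0 <= / (1 - p) by apply: Rlt_le; apply: Rinv_0_lt_compat; lra.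
apply: Rle_trans (_ : (3 * INR s / INR j) ^ j * ((INR s / INR m) ^ j * (T ^ j * E ^ j)) <= _).
  apply: Rmult_le_compat; [exact: pos_INR | | exact: bin_upper |].
    apply: Rmult_le_pos; first exact: pow_le.
    by apply: Rmult_le_pos; apply: pow_le.
  apply: Rmult_le_compat_l; first exact: pow_le.
  apply: Rmult_le_compat => //; try exact: pow_le.
  exact: pow_incr.
rewrite -!Rpow_mult_distr; apply: pow_incr; split.
  apply: Rmult_le_pos; first by apply: Rle_mult_inv_pos; lra.
  by apply: Rmult_le_pos => //; apply: Rmult_le_pos; lra.
have -> : 3 * INR s / INR j * (INR s / INR m * (T * E)) =
    / 11 * ((33 * INR s * INR s * T * E) * / (INR j * INR m)) by field; lra.
have jm : 0 < INR j * INR m by apply: Rmult_lt_0_compat.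
rewrite -[X in _ <= X]Rmult_1_r; apply: Rmult_le_compat_l; first lra.
apply: (Rmult_le_reg_r (INR j * INR m)) => //.
by rewrite Rmult_assoc Rinv_l ?Rmult_1_r ?Rmult_1_l //; lra.
Qed.

Lemma good_event_probable conn :
  1 / 2 < gnp_prob p (@good_event 2 n ((2 * h).+1 + s) conn).
Proof.
have h0 : (0 < h)%nat.
  by apply/ssrnat.ltP/INR_lt; have := ex_gt0 (alpha - delta); rewrite /=; lra.
apply: (@gnp_prob_good_event n m (2 * h) s p conn p01 _ _ m_gt0 m_hi s_le_m
  path_estimate closing_estimate pendant_estimate).
- by rewrite mul2n odd_double.
- by rewrite mul2n; case: (h) h0.
Qed.
End Regime.
End Estimates.

(** * From probable events to the lower bounds *)

Lemma leq_u_gen conn d n (p : R) k : (0 < k)%nat ->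
  (1 / 2 < gnp_prob p (@good_event d n k conn))%R -> (k <= u_gen conn d n p)%nat.
Proof.
move=> k0 half; have kn : (k < n.+1)%nat.
  rewrite ltnS leqNgt; apply/negP => nk.
  suff p0 : gnp_prob p (@good_event d n k conn) = 0%R by rewrite p0 in half; lra.
  apply: big1 => g _.
  case: (ClassicalDescription.excluded_middle_informative (good_event d k conn g)) => // good_g.
  have [W [cW _]] := good_g; have : (k <= n)%nat by rewrite -cW -[X in (_ <= X)%nat]card_ord max_card.
  by rewrite leqNgt nk.
rewrite /u_gen (bigD1 (Ordinal kn)) /= ?leq_maxl //.
by rewrite k0; case: Rlt_dec.
Qed.

Lemma u_gen_lower (alpha C eps delta x p : R) (n : nat) (conn : bool)
    (kappa := (2 - 2 * alpha - eps)%R) :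
  (0 < alpha < 1 / 2 -> 0 < C -> 0 < delta -> 4 * delta <= alpha ->
   4 * delta <= 1 - 2 * alpha -> 4 * delta <= eps -> 0 < kappa -> 12 <= x -> INR n = exp x ->
   exp (- alpha * x) < p -> p < C * exp (- alpha * x) ->
   100000 * (1 + C) * (1 + / delta) * (x * x) <= exp (delta * x) ->
   kappa * x / p <= INR (u_gen conn 2 n p))%R.
Proof.
move=> a C0 d0 da da2 de k0 x12 nE p_lo p_hi big.
have x1 : (1 <= x)%R by lra.
have p0 : (0 < p)%R by have := exp_pos (- alpha * x); lra.
have [h [h_lo h_hi]] := exists_ceil (Rlt_le _ _ (exp_pos ((alpha - delta) * x))).
have kx : (0 <= kappa * x / p)%R.
  by apply: Rle_mult_inv_pos => //; apply: Rmult_le_pos; lra.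
have [s [s_lo s_hi]] := exists_ceil kx.
pose m := n %/ 3.
have m_hi : (3 * m <= n)%nat by rewrite mulnC leq_divM.
have m_lo : (INR n / 4 <= INR m)%R.
  have n12 : (12 <= INR n)%R by rewrite nE; have := exp_ineq1_le x; lra.
  have : (n <= 3 * m + 2)%nat.
    by rewrite {1}(divn_eq n 3) mulnC leq_add2l -ltnS ltn_pmod.
  by move=> /ssrnat.leP/le_INR; rewrite plus_INR mult_INR /=; lra.
apply: (Rle_trans _ _ _ s_lo); apply: le_INR; apply/ssrnat.leP.
(* The pendants alone reach the bound; the cycle vertices are given away. *)
apply: leq_trans (leq_addl (2 * h).+1 s) (leq_u_gen _ _); first by rewrite addSn.
exact: (good_event_probable a C0 d0 da da2 de k0 x1 nE p_lo p_hi big h_lo h_hi m_lo m_hi s_lo s_hi).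
Qed.

Theorem theorem18 (alpha C : R) (p : nat -> R) :
  (0 < alpha < 1/2)%R -> (0 < C)%R ->
  (exists N : nat, forall n : nat, (N <= n)%coq_nat ->
       (1 < p n * Rpower (INR n) alpha < C)%R) ->
  forall eps : R, (0 < eps)%R ->
  exists n0 : nat, forall n : nat, (n0 <= n)%coq_nat ->
    ((2 - 2 * alpha - eps) * ln (INR n) / p n <= INR (u_d 2 n (p n)))%R /\
    ((2 - 2 * alpha - eps) * ln (INR n) / p n <= INR (u_d' 2 n (p n)))%R.
Proof.
move=> a C0 [N pN] eps eps0.
(* The quarter is what [T * T <= ex (eps / 2)] requires; it also gives
   [T * T * T <= ex (1 - 2 * alpha)]. *)
pose delta := (Rmin alpha (Rmin (1 - 2 * alpha) eps) / 4)%R.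
have [d0 [da [da2 de]]] : (0 < delta /\ 4 * delta <= alpha /\
    4 * delta <= 1 - 2 * alpha /\ 4 * delta <= eps)%R.
  have := Rmin_l alpha (Rmin (1 - 2 * alpha) eps).
  have := Rmin_r alpha (Rmin (1 - 2 * alpha) eps).
  have := Rmin_l (1 - 2 * alpha) eps; have := Rmin_r (1 - 2 * alpha) eps.
  have : (0 < Rmin alpha (Rmin (1 - 2 * alpha) eps))%R by repeat apply: Rmin_glb_lt; lra.
  by rewrite /delta; repeat split; lra.
pose K := (100000 * (1 + C) * (1 + / delta))%R.
have K0 : (0 < K)%R.
  have di := Rinv_0_lt_compat _ d0.
  by apply: Rmult_lt_0_compat; [apply: Rmult_lt_0_compat|]; lra.
have [X XP] := exp_dominates_square d0 K0.
(* The 12 makes n large enough for n / 3, rounded down, to be at least n / 4. *)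
have [n1 [n1X _]] := exists_ceil (Rlt_le _ _ (exp_pos (Rmax X 12))).
exists (N + n1)%coq_nat => n n0n.
have Nn : (N <= n)%coq_nat by lia.
have xn : (exp (Rmax X 12) <= INR n)%R.
  by apply: Rle_trans n1X _; apply: le_INR; lia.
have n_gt0 : (0 < INR n)%R by have := exp_pos (Rmax X 12); lra.
pose x := ln (INR n); have nE : INR n = exp x by rewrite exp_ln.
have [xX x12] : (X <= x /\ 12 <= x)%R.
  have : (Rmax X 12 <= x)%R.
    by apply: Rnot_lt_le => /exp_increasing; rewrite -nE; lra.
  by have := Rmax_l X 12; have := Rmax_r X 12; lra.
have [x1 big] := XP x xX.
have [lo hi] := pN n Nn; rewrite /Rpower -/x in lo hi.
have e0 := exp_pos (alpha * x).
have eE : (exp (- alpha * x) * exp (alpha * x) = 1)%R.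
  by rewrite -exp_plus -exp_0; congr exp; ring.
have p_lo : (exp (- alpha * x) < p n)%R.
  by apply: (Rmult_lt_reg_r (exp (alpha * x))) => //; rewrite eE.
have p_hi : (p n < C * exp (- alpha * x))%R.
  by apply: (Rmult_lt_reg_r (exp (alpha * x))) => //; rewrite Rmult_assoc eE Rmult_1_r.
have p0 : (0 < p n)%R by have := exp_pos (- alpha * x); lra.
suff lower conn : ((2 - 2 * alpha - eps) * x / p n <= INR (u_gen conn 2 n (p n)))%R.
  by split; apply: lower.
have [k_gt0|k_le0] := Rlt_or_le 0 (2 - 2 * alpha - eps).
  exact: (u_gen_lower conn a C0 d0 da da2 de k_gt0 x12 nE p_lo p_hi big).
(* For large [eps] the claimed bound is not positive. *)
apply: Rle_trans (pos_INR _).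
have ip : (0 <= / p n)%R by apply: Rlt_le; apply: Rinv_0_lt_compat.
have kx : ((2 - 2 * alpha - eps) * x <= 0)%R by nra.
by rewrite /Rdiv; nra.
Qed.
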